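(* Let $\mu$ be a nonzero bounded $\mathbb{C}$-valued Borel measure on $[a,b]$, let $\lambda_1,\dots,\lambda_k\in\Lambda_\mu$ be pairwise distinct and let $m_1,\dots,m_k\in\mathbb{N}$ with $m_i\leq m(\mathscr{S}_\mu,\lambda_i)$ for $i\in\{1,\dots,k\}$. Put $n:=m_1+\dots+m_k$ and define $c=(c_0,\dots,c_n)\in\mathbb{C}^{n+1}$ by $$(\lambda-\lambda_1)^{m_1}\cdots(\lambda-\lambda_k)^{m_k}=c_n\lambda^n+\dots+c_1\lambda+c_0\qquad(\lambda\in\mathbb{C}),$$ and $D_c:\mathscr{C}^n_{\mathbb{C}}([a,b])\to\mathscr{C}_{\mathbb{C}}([a,b])$ by $D_c(f):=c_nf^{(n)}+\dots+c_1f'+c_0f$. Let $\omega_c$ be the characteristic solution of $D_c(\omega)=0$ and define $g:[a,b]\to\mathbb{C}$ by $g(t):=\int_{[t,b]}\omega_c(x-t)\,d\mu(x)$. Write $\mathscr{A}_\mu(f):=\int_{[a,b]}f(x)\,d\mu(x)$. Then, for all $f\in\mathscr{C}^n_{\mathbb{C}}([a,b])$ and for all $p,q\in[1,\infty]$ with $\frac1p+\frac1q=1$, $$|\mathscr{A}_\mu(f)|\leq\|D_c(f)\|_p\cdot\|g\|_q.$$ If, in addition, $c=(c_0,\dots,c_n)\in\mathbb{R}^{n+1}$, $\mu$ is a real-valued measure, $f\in\mathscr{C}^n_{\mathbb{R}}([a,b])$, and both $g$ and $D_c(f)$ are nonnegative (or both are nonpositive) on $[a,b]$, then $$\mathscr{A}_\mu(f)\geq0.$$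 If $g$ and $D_c(f)$ have opposite signs over $[a,b]$ (one is nonnegative and the other is nonpositive), then this inequality reverses, i.e. $\mathscr{A}_\mu(f)\leq 0$.
   Context: $[a,b]$ is a compact interval; for $\mathbb{K}\in\{\mathbb{R},\mathbb{C}\}$, $\mathscr{C}^n_{\mathbb{K}}([a,b])$ is the space of $n$ times continuously differentiable $\mathbb{K}$-valued functions on $[a,b]$, and $\mathscr{C}_{\mathbb{K}}([a,b]):=\mathscr{C}^0_{\mathbb{K}}([a,b])$. $\mathbb{N}$ denotes the positive integers. For the measure $\mu$, the spectral function is the entire function $\mathscr{S}_\mu(\lambda):=\int_{[a,b]}e^{\lambda x}\,d\mu(x)$ ($\lambda\in\mathbb{C}$). The spectral set $\Lambda_\mu\subseteq\mathbb{C}$ is the set of zeros of $\mathscr{S}_\mu$. For $\lambda\in\Lambda_\mu$, $m(\mathscr{S}_\mu,\lambda)$ is the multiplicity of $\lambda$ as a zero of $\mathscr{S}_\mu$, i.e. the largest $m\in\mathbb{N}$ such that $\mathscr{S}_\mu^{(j)}(\lambda)=\int_{[a,b]}x^je^{\lambda x}\,d\mu(x)=0$ for all $j\in\{0,\dots,m-1\}$. The characteristic solution $\omega_c$ of $D_c(\omega)=0$ is the unique solution on $\mathbb{R}$ of the initial value problem $c_n\omega^{(n)}+\dots+c_1\omega'+c_0\omega=0$, $\omega^{(i)}(0)=\delta_{i,n-1}$ for $i\in\{0,\dots,n-1\}$, where $\delta$ is the Kronecker symbol. For a Lebesgue measurable $f:[a,b]\to\mathbb{C}$, $\|f\|_p:=\big(\int_{[a,b]}|f(t)|^p\,dt\big)^{1/p}$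 if $p\in[1,\infty)$, and $\|f\|_\infty$ is the essential supremum of $|f|$ on $[a,b]$. *)

(* Defs.v *)
From HB Require Import structures.
From mathcomp Require Import all_boot all_order all_algebra.
From mathcomp Require Import complex.
From mathcomp Require Import all_classical all_reals all_analysis.

Set Implicit Arguments.
Unset Strict Implicit.
Unset Printing Implicit Defensive.

Import Order.TTheory GRing.Theory Num.Theory.
Import numFieldNormedType.Exports.

Local Open Scope classical_set_scope.
Local Open Scope complex_scope.
Local Open Scope ring_scope.

(* The norm topology of [R[i]], needed to speak of limits in [R[i]]. *)
HB.instance Definition _ (R : realType) := NormedModule.copy R[i] R[i]^o.

(* Note on the order: in [R[i]], [0 <= z] means that [z] is real and
   nonnegative, [z <= 0] that it is real and nonpositive. *)

Definition cexp (R : realType) (z : R[i]) : R[i] :=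
  (expR (complex.Re z) * cos (complex.Im z)) +i*
  (expR (complex.Re z) * sin (complex.Im z)).

(* A finite-valued sigma-additive set function with values in [R[i]]; the
   boundedness of such a set function is automatic. Values on non-measurable
   sets are irrelevant. *)
Record complex_measure d (T : measurableType d) (R : realType) :=
  ComplexMeasure {
    cmeas :> set T -> R[i];
    cmeas0 : cmeas set0 = 0;
    cmeas_sigma_additive : forall F : nat -> set T,
      (forall k, measurable (F k)) -> trivIset [set: nat] F ->
      (fun m => \sum_(0 <= k < m) cmeas (F k)) @ \oo
        --> cmeas (\bigcup_k F k) }.

Section re_im_charge.
Context d (T : measurableType d) (R : realType).
Variable mu : complex_measure T R.

Definition re_charge (A : set T) : \bar R := (complex.Re (mu A))%:E.
Definition im_charge (A : set T) : \bar R := (complex.Im (mu A))%:E.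

Let part_cvg (h : R[i] -> R) (F : nat -> set T) :
  (forall x y, h (x + y) = h x + h y) ->
  (forall z : R[i], `|h z|%:C <= `|z|) ->
  (forall k, measurable (F k)) -> trivIset [set: nat] F ->
  (fun m => (\sum_(0 <= k < m) (h (mu (F k)))%:E)%E) @ \oo
    --> (h (mu (\bigcup_k F k)))%:E.
Proof.
move=> hD hle mF tF.
have h0 : h 0 = 0 by apply: (addIr (h 0)); rewrite -hD !add0r.
have hN z : h (- z) = - h z.
  by apply: (addrI (h z)); rewrite -hD !subrr.
under eq_fun do rewrite sumEFin -(big_morph h hD h0).
apply: cvg_EFin; first exact: nearW.
apply/cvgrPdist_lt => e e0; near=> m => /=.
rewrite -hN -hD -ltcR; apply: le_lt_trans (hle _) _.
near: m; have /cvgrPdist_lt := cmeas_sigma_additive (c := mu) mF tF.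
by apply; rewrite ltcR.
Unshelve. all: by end_near. Qed.

Let re_charge0 : re_charge set0 = 0%E.
Proof. by rewrite /re_charge cmeas0. Qed.

Let re_charge_fin A : measurable A -> re_charge A \is a fin_num.
Proof. by []. Qed.

Let re_charge_sigma : semi_sigma_additive re_charge.
Proof.
move=> F mF tF _; apply: (part_cvg (h := @complex.Re R)) => //.
  by move=> [? ?] [? ?].
exact: normc_ge_Re.
Qed.

HB.instance Definition _ := isCharge.Build _ T R re_charge
  re_charge0 re_charge_fin re_charge_sigma.

Let im_charge0 : im_charge set0 = 0%E.
Proof. by rewrite /im_charge cmeas0. Qed.

Let im_charge_fin A : measurable A -> im_charge A \is a fin_num.
Proof. by []. Qed.

Let im_charge_sigma : semi_sigma_additive im_charge.
Proof.
move=> F mF tF _; apply: (part_cvg (h := @complex.Im R)) => //.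
  by move=> [? ?] [? ?].
move=> [x y] /=; rewrite lecR -[leLHS]sqrtr_sqr ler_wsqrtr//.
by rewrite lerDr sqr_ge0.
Qed.

HB.instance Definition _ := isCharge.Build _ T R im_charge
  im_charge0 im_charge_fin im_charge_sigma.

End re_im_charge.

Section integral.
Context d (T : measurableType d) (R : realType).

(* A Hahn decomposition is chosen; the Jordan decomposition, hence the
   integral, does not depend on it ([Hahn_decomposition_uniq]). *)
Lemma Hahn_decomposition_pair (nu : {charge set T -> \bar R}) :
  exists PN : set T * set T, hahn_decomposition nu PN.1 PN.2.
Proof. by have [P [N PN]] := Hahn_decomposition nu; exists (P, N). Qed.

Definition hahnPN (nu : {charge set T -> \bar R}) :=
  projT2 (cid (Hahn_decomposition_pair nu)).

Definition charge_integral (nu : {charge set T -> \bar R}) (D : set T)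
    (f : T -> R) : R :=
  \int[jordan_pos (hahnPN nu)]_(x in D) f x -
  \int[jordan_neg (hahnPN nu)]_(x in D) f x.

Definition cintegral (mu : complex_measure T R) (D : set T) (f : T -> R[i]) :
    R[i] :=
  let u x := complex.Re (f x) in
  let v x := complex.Im (f x) in
  (charge_integral (re_charge mu) D u - charge_integral (im_charge mu) D v) +i*
  (charge_integral (re_charge mu) D v + charge_integral (im_charge mu) D u).

End integral.

Section derivative.
Variable R : realType.
Implicit Types (D : set R) (f : R -> R[i]).

(* [y] tends to [x] within [D \ {x}]: for [D = `[a, b]] this is the usual
   derivative inside and the one-sided derivative at the endpoints; only the
   values of [f] on [D] matter at points of [D]. *)
Definition diff_quotient D f (x : R) : set_system R[i] :=
  ((fun y : R => (f y - f x) / (y - x)%:C : R[i]) @ within D (dnbhs x)).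

Definition derivable_on D f x := cvg (diff_quotient D f x).

Definition derive_on D f (x : R) : R[i] := lim (diff_quotient D f x).

Definition deriven_on D (n : nat) f : R -> R[i] := iter n (derive_on D) f.

Definition n_derivable_on D (n : nat) f :=
  forall i, (i < n)%N -> forall x, D x -> derivable_on D (deriven_on D i f) x.

Definition Cn_on D (n : nat) f :=
  n_derivable_on D n f /\ {within D, continuous (deriven_on D n f)}.

Definition diff_op D (n : nat) (c : 'I_n.+1 -> R[i]) f (x : R) : R[i] :=
  \sum_(j < n.+1) c j * deriven_on D j f x.

Definition characteristic_solution (n : nat) (c : 'I_n.+1 -> R[i])
    (w : R -> R[i]) :=
  [/\ n_derivable_on [set: R] n w,
      forall x, diff_op [set: R] c w x = 0 &
      forall i, (i < n)%N -> deriven_on [set: R] i w 0 = (i == n.-1)%:R].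

End derivative.

Section spectral.
Variable R : realType.
Variables (a b : R) (mu : complex_measure (measurableTypeR R) R).

Definition spectral_function (l : R[i]) : R[i] :=
  cintegral mu `[a, b] (fun x : R => cexp (l * x%:C)).

Definition spectral_set : set R[i] := [set l | spectral_function l = 0].

(* The largest [m] such that the complex derivatives of [S] of orders
   [0, ..., m - 1] vanish at [l]. The default value [0] is returned only when
   there is no largest such [m]. *)
Definition zero_multiplicity (S : R[i] -> R[i]) (l : R[i]) : nat :=
  let vanish m := forall j, (j < m)%N -> derive1n j S l = 0 in
  xget 0%N [set m | vanish m /\ forall m', vanish m' -> (m' <= m)%N].

(* [mu], a measure on the whole line, is carried by [`[a, b]]: this is how
   Borel measures on [`[a, b]] are represented. *)
Definition carried_by_itv :=
  forall A : set (measurableTypeR R), measurable A -> mu A = mu (A `&` `[a, b]).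

End spectral.

(* The [L^p] norm on [`[a, b]] for the Lebesgue measure, valued in [\bar R]. *)
Definition Lnorm_itv (R : realType) (a b : R) (p : \bar R) (h : R -> R[i]) :
    \bar R :=
  Lnorm (mrestr (@lebesgue_measure R) (measurable_itv `[a, b])) p
    (fun x => (Normc.normc (h x))%:E).

Definition kernel_fun (R : realType) (b : R)
    (mu : complex_measure (measurableTypeR R) R) (w : R -> R[i]) (t : R) :
    R[i] :=
  cintegral mu `[t, b] (fun x : R => w (x - t)).

(* Main.v *)
(* Let W_i denote the i-th derivative of the characteristic solution and put
   B_x(t) := sum_j c_j sum_(i < j) W_i(x - t) f^(j-1-i)(t). By the Lagrange
   identity B_x'(t) = w(x - t) D_c(f)(t), and B_x(x) = f(x) by the initial
   values of w, so that
     f(x) = B_x(a) + int_a^x w(x - t) D_c(f)(t) dt.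
   As a function of x, B_x(a) is a combination of the translates W_i(x - a) of
   solutions of the homogeneous equation, hence of functions
   x^j exp(lambda_r x) with j < m_r, whose mu-integrals are the derivatives of
   the spectral function at lambda_r and vanish. Fubini then gives
     A_mu(f) = int_a^b g(t) D_c(f)(t) dt,
   from which Hoelder's inequality and the sign statements follow. *)

Require Import Defs.
From HB Require Import structures.
From mathcomp Require Import all_boot all_order all_algebra.
From mathcomp Require Import complex ring.
From mathcomp Require Import all_classical all_reals all_analysis.
From mathcomp Require Import measurable_realfun lebesgue_Rintegral ess_sup_inf.

Set Implicit Arguments.
Unset Strict Implicit.
Unset Printing Implicit Defensive.

Import Order.TTheory GRing.Theory Num.Theory.
Import numFieldNormedType.Exports.

Local Open Scope classical_set_scope.
Local Open Scope complex_scope.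
Local Open Scope ring_scope.

(** * Complex exponential and derivatives of complex functions *)

(** Two steps hide most of the work. The multiplicity of a zero is defined through iterated complex
    derivatives of the spectral function, so the integral has to be differentiated under its sign in
    a complex parameter; an explicit second-order bound for the exponential gives this uniformly on
    the interval. Moreover, the integrals of the translates of [w] are shown to vanish without a
    basis of solutions: polynomials act on [w] as constant coefficient operators, and an induction
    on the list of roots uses two distinct roots to shorten the list, until only powers of one
    linear factor remain.

    Regularity shapes the rest. The derivatives of [f] are taken relative to the compact interval,
    so the Lagrange identity is differentiated on the open interval only, and relative continuity
    covers the endpoints. All integrals are reduced to finite positive measures and bounded
    measurable functions, a class closed under sums and products in which integrability is
    automatic. *)

Section complex_facts.
Variable R : realType.
Implicit Types (z u v : R[i]) (x y : R).

Lemma normcE_normr z : `|z| = (Normc.normc z)%:C.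
Proof. by []. Qed.

Lemma normc_ge0 z : 0 <= Normc.normc z.
Proof. by case: z => x y; exact: sqrtr_ge0. Qed.

Lemma Re_le_normc z : `|complex.Re z| <= Normc.normc z.
Proof. by rewrite -lecR; exact: normc_ge_Re. Qed.

Lemma Im_le_normc z : `|complex.Im z| <= Normc.normc z.
Proof.
case: z => x y /=; rewrite -[leLHS]sqrtr_sqr ler_wsqrtr//.
by rewrite lerDr sqr_ge0.
Qed.

Lemma normc_le_ReIm z : Normc.normc z <= `|complex.Re z| + `|complex.Im z|.
Proof.
have {1}-> : z = (complex.Re z)%:C + (complex.Im z) *i.
  by case: z => x y; apply/eqP; rewrite eq_complex /= addr0 add0r !eqxx.
apply: (le_trans (le_normcD _ _)) => /=.
by rewrite !expr0n /= addr0 add0r !sqrtr_sqr.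
Qed.

Lemma cReD u v : complex.Re (u + v) = complex.Re u + complex.Re v.
Proof. by case: u v => [? ?] [? ?]. Qed.
Lemma cImD u v : complex.Im (u + v) = complex.Im u + complex.Im v.
Proof. by case: u v => [? ?] [? ?]. Qed.
Lemma cReM u v : complex.Re (u * v) =
  complex.Re u * complex.Re v - complex.Im u * complex.Im v.
Proof. by case: u v => [? ?] [? ?]. Qed.
Lemma cImM u v : complex.Im (u * v) =
  complex.Re u * complex.Im v + complex.Im u * complex.Re v.
Proof. by case: u v => [? ?] [? ?]. Qed.
Lemma cReN u : complex.Re (- u) = - complex.Re u.
Proof. by case: u. Qed.
Lemma cImN u : complex.Im (- u) = - complex.Im u.
Proof. by case: u. Qed.

Lemma complexP u v : complex.Re u = complex.Re v ->
  complex.Im u = complex.Im v -> u = v.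
Proof. by case: u v => [? ?] [? ?] /= -> ->. Qed.

Lemma cexpD u v : cexp (u + v) = cexp u * cexp v.
Proof.
apply: complexP; rewrite ?cReM ?cImM /cexp /= cReD cImD expRD ?cosD ?sinD; ring.
Qed.

Lemma cexp0 : cexp (0 : R[i]) = 1.
Proof. by apply: complexP; rewrite /= expR0 ?cos0 ?sin0; ring. Qed.

Lemma cexpNK u : cexp u * cexp (- u) = 1.
Proof. by rewrite -cexpD subrr cexp0. Qed.

Lemma normc_cexp u : Normc.normc (cexp u) = expR (complex.Re u).
Proof.
rewrite /= !exprMn -mulrDr cos2Dsin2 mulr1 sqrtr_sqr.
by rewrite ger0_norm// expR_ge0.
Qed.

End complex_facts.

Section cder.
Variable R : realType.
Implicit Types (F G : R -> R[i]) (x y : R) (u v l : R[i]).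

(* [l] is the (two-sided) derivative of [F] at [x]; it is taken componentwise so
   that the real-valued calculus of the library applies. *)
Definition cder F x l :=
  is_derive x 1 (fun y => complex.Re (F y)) (complex.Re l) /\
  is_derive x 1 (fun y => complex.Im (F y)) (complex.Im l).

Lemma cder_eq F x u v : cder F x u -> u = v -> cder F x v.
Proof. by move=> ? <-. Qed.

Lemma cder_ext F G x u : F =1 G -> cder F x u -> cder G x u.
Proof. by move=> /funext <-. Qed.

Lemma cder_cst u x : cder (cst u) x 0.
Proof. by split; exact: is_derive_cst. Qed.

Lemma cderD F G x u v : cder F x u -> cder G x v ->
  cder (fun y => F y + G y) x (u + v).
Proof.
move=> [? ?] [? ?]; split; under eq_fun do rewrite ?cReD ?cImD;
  rewrite ?cReD ?cImD; exact: is_deriveD.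
Qed.

Lemma cderN F x u : cder F x u -> cder (fun y => - F y) x (- u).
Proof.
move=> [? ?]; split; under eq_fun do rewrite ?cReN ?cImN;
  rewrite ?cReN ?cImN; exact: is_deriveN.
Qed.

Lemma cderM F G x u v : cder F x u -> cder G x v ->
  cder (fun y => F y * G y) x (u * G x + F x * v).
Proof.
move=> [? ?] [? ?]; split; under eq_fun do rewrite ?cReM ?cImM.
  apply: is_derive_eq; rewrite cReD !cReM /GRing.scale /=; ring.
apply: is_derive_eq; rewrite cImD !cImM /GRing.scale /=; ring.
Qed.

Lemma cderZ F x u l : cder F x u -> cder (fun y => l * F y) x (l * u).
Proof.
move=> Fu; apply: (cder_eq (cderM (cder_cst l x) Fu)).
by rewrite mul0r add0r.
Qed.

Lemma cder_sum (I : Type) (r : seq I) (P : pred I) (F : I -> R -> R[i]) x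
    (u : I -> R[i]) :
  (forall i, P i -> cder (F i) x (u i)) ->
  cder (fun y => \sum_(i <- r | P i) F i y) x (\sum_(i <- r | P i) u i).
Proof.
move=> Fu; elim: r => [|i r IH].
  by under [fun y => _]eq_fun do rewrite big_nil; rewrite big_nil;
    exact: cder_cst.
under [fun y => _]eq_fun do rewrite big_cons; rewrite big_cons.
by case: ifPn => // Pi; apply: cderD => //; exact: Fu.
Qed.

Lemma cder_id x : cder (fun y => y%:C) x 1.
Proof. by split; [exact: is_derive_id|exact: is_derive_cst]. Qed.

Lemma cder_exp l x :
  cder (fun y => cexp (l * y%:C)) x (l * cexp (l * x%:C)).
Proof.
case: l => a b; split => /=; under eq_fun do rewrite !mulr0 ?subr0 ?add0r.
  rewrite !mulr0 subr0 add0r.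
  apply: is_derive_eq; rewrite /GRing.scale /=; ring.
rewrite !mulr0 subr0 add0r.
apply: is_derive_eq; rewrite /GRing.scale /=; ring.
Qed.

Lemma cder_affine F (k d : R) x u : cder F (k * x + d) u ->
  cder (fun y => F (k * y + d)) x (k%:C * u).
Proof.
move=> [? ?]; have dk : is_derive x 1 (fun y : R => k * y + d) k.
  by apply: is_derive_eq; rewrite /GRing.scale /= mulr1 addr0.
split.
  rewrite cReM /= mul0r subr0 mulrC.
  by apply: (@is_derive1_comp _ (fun y => complex.Re (F y)) (fun y => k * y +
    d)).
rewrite cImM /= mul0r addr0 mulrC.
by apply: (@is_derive1_comp _ (fun y => complex.Im (F y)) (fun y => k * y + d)).
Qed.

Lemma cder_shift F d x u : cder F (x - d) u -> cder (fun y => F (y - d)) x u.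
Proof.
have e (y : R) : y - d = 1 * y + - d by rewrite mul1r.
rewrite e => /cder_affine; rewrite mul1r; apply: cder_ext => y; by rewrite e.
Qed.

Lemma cder_refl F d x u : cder F (d - x) u -> cder (fun y => F (d - y)) x (- u).
Proof.
have e (y : R) : d - y = -1 * y + d by rewrite mulN1r addrC.
rewrite e => /cder_affine; rewrite rmorphN1 mulN1r.
by apply: cder_ext => y; by rewrite e.
Qed.

Definition ccts F := continuous (fun y => complex.Re (F y)) /\
  continuous (fun y => complex.Im (F y)).

Lemma cder_continuous F G : (forall x, cder F x (G x)) -> ccts F.
Proof.
move=> FG; split=> x; apply: differentiable_continuous; apply/derivable1_diffP.
  by have [[]] := FG x.
by have [_ []] := FG x.
Qed.

Lemma cder0_cst F x y : (forall z, cder F z 0) -> F x = F y.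
Proof.
move=> F0; apply: complexP.
  by apply: (@is_derive_0_is_cst _ (fun y => complex.Re (F y))) => z;
    case: (F0 z).
by apply: (@is_derive_0_is_cst _ (fun y => complex.Im (F y))) => z;
  case: (F0 z).
Qed.

(** The mean value theorem has no exact complex analogue. Its real form is applied to the real and
    imaginary parts, at two possibly different points, which costs the factor 2. *)
Lemma cder_bound F G K : (forall x, cder F x (G x)) ->
  (forall s, 0 <= s <= 1 -> Normc.normc (G s) <= K) ->
  Normc.normc (F 1 - F 0) <= 2 * K.
Proof.
move=> FG GK; have [cR cI] := cder_continuous FG.
have [s _||s s01 eR] := @MVT _ (fun y => complex.Re (F y))
    (fun y => complex.Re (G y)) 0 1 ltr01.
- by case: (FG s).
- exact: continuous_subspaceT.
have [t _||t t01 eI] := @MVT _ (fun y => complex.Im (F y))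
    (fun y => complex.Im (G y)) 0 1 ltr01.
- by case: (FG t).
- exact: continuous_subspaceT.
apply: (le_trans (normc_le_ReIm _)).
rewrite cReD cImD cReN cImN eR eI subr0 !mulr1 mulr2n mulrDl mul1r.
move: s01 t01; rewrite !in_itv /= => /andP[s0 s1] /andP[t0 t1].
apply: lerD.
  by apply: (le_trans (Re_le_normc _)); apply: GK; rewrite !ltW.
by apply: (le_trans (Im_le_normc _)); apply: GK; rewrite !ltW.
Qed.

End cder.

Section diff_quotient.
Variable R : realType.
Implicit Types (D : set R) (f : R -> R[i]) (x : R) (l : R[i]).

Lemma diff_quotient_ball D f x l : diff_quotient D f x --> l ->
  forall e, 0 < e -> exists2 d, 0 < d & forall y, D y -> y != x ->
    `|y - x| < d -> Normc.normc (l - (f y - f x) / (y - x)%:C) < e.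
Proof.
move=> /cvgrPdist_lt fl e e0.
have /fl : 0 < e%:C :> R[i] by rewrite ltcR.
rewrite near_withinE /dnbhs near_withinE => -[d /= d0 dD].
exists d => // y Dy yx yxd.
by rewrite -ltcR; apply: (dD y) => //=; rewrite distrC.
Qed.

Lemma cReMr (u : R[i]) (k : R) : complex.Re (u * k%:C) = complex.Re u * k.
Proof. by rewrite cReM /= mulr0 subr0. Qed.

Lemma cImMr (u : R[i]) (k : R) : complex.Im (u * k%:C) = complex.Im u * k.
Proof. by rewrite cImM /= mulr0 add0r. Qed.

(** When [D] is a neighbourhood of [x], small increments stay in [D], so the limit within [D] is an
    ordinary two-sided limit. *)
Lemma diff_quotient_cder D f x l : nbhs x D -> diff_quotient D f x --> l ->
  cder f x l.
Proof.
move=> [r /= r0 rD] /diff_quotient_ball fl.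
(* Real and imaginary parts are treated at once: only additivity, real homogeneity and domination by
   the modulus matter. *)
have H (h : R[i] -> R) : (forall u v, h (u - v) = h u - h v) ->
    (forall u (k : R), h (u * k%:C) = h u * k) ->
    (forall u, `|h u| <= Normc.normc u) ->
    is_derive x 1 (fun y => h (f y)) (h l).
  move=> hB hM hle.
  have : (fun k => k^-1 *: (((fun y => h (f y)) \o shift x) (k *: (1 :
    R)) - h (f x)))
      @ 0^' --> h l.
    apply/cvgrPdist_lt => e e0; have [d d0 dP] := fl e e0.
    near=> k; have k0 : k != 0 by near: k; exact: nbhs_dnbhs_neq.
    have kd : `|k| < d by near: k; apply: dnbhs0_lt.
    have kr : `|k| < r by near: k; apply: dnbhs0_lt.
    rewrite /= /GRing.scale /= mulr1 -hB mulrC -hM -hB.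
    apply: (le_lt_trans (hle _)).
    have := dP (k + x); rewrite addrK fmorphV; apply => //.
    - by apply: rD => /=; rewrite opprD addrCA subrr addr0 normrN.
    - by rewrite -subr_eq0 addrK.
  by move=> c; split; [apply/cvg_ex; exists (h l)|exact: cvg_lim c].
split; [apply: (H (@complex.Re R))|apply: (H (@complex.Im R))].
- by move=> u v; rewrite cReD cReN.
- exact: cReMr.
- exact: Re_le_normc.
- by move=> u v; rewrite cImD cImN.
- exact: cImMr.
- exact: Im_le_normc.
Unshelve. all: by end_near.
Qed.

Lemma cvg_derive_on D f x : derivable_on D f x ->
  diff_quotient D f x --> derive_on D f x.
Proof. by []. Qed.

(** Near [x] the quotient is bounded by [|l| + 1], so the increment of [f] is at most this constant
    times [|y - x|]. All is relative to [D], which covers the endpoints of an interval. *)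
Lemma diff_quotient_continuous D f x l : 
  diff_quotient D f x --> l -> f @ within D (nbhs x) --> f x.
Proof.
move=> /diff_quotient_ball fl; apply/cvgrPdist_lt => e e0.
have [d d0 dP] := fl 1 ltr01.
(* A positive element of [R[i]] is real, so the tolerance can be taken in [R]. *)
have /complex_realP[e' ee'] : e \is Num.real by exact: gtr0_real.
move: e0; rewrite ee' ltcR => e0.
have M0 : 0 < Normc.normc l + 1 by rewrite ltr_wpDl ?normc_ge0.
rewrite near_withinE; near=> y => Dy.
have [->|yx] := eqVneq y x; first by rewrite subrr normr0 ltcR.
have yd : `|y - x| < d.
  by near: y; apply/nbhs_ballP; exists d => //= z; rewrite /ball_ distrC.
have ye : `|y - x| < e' / (Normc.normc l + 1).
  near: y; apply/nbhs_ballP; exists (e' / (Normc.normc l + 1)).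
    exact: divr_gt0.
  by move=> z /=; rewrite /ball_ distrC.
have yx0 : (y - x)%:C != 0 by rewrite (inj_eq (@complexI _) _ 0) subr_eq0.
have := dP y Dy yx yd => q.
have q1 : Normc.normc ((f y - f x) / (y - x)%:C) <= Normc.normc l + 1.
  rewrite -[X in Normc.normc X](subKr l).
  apply: (le_trans (le_normcD _ _)); rewrite normcN lerD2l.
  exact: ltW.
rewrite distrC -[f y - f x](divfK yx0) normcE_normr ltcR Normc.normcM.
rewrite /= expr0n addr0 sqrtr_sqr.
apply: (@le_lt_trans _ _ ((Normc.normc l + 1) * `|y - x|)).
  by rewrite ler_wpM2r.
by rewrite mulrC -ltr_pdivlMr.
Unshelve. all: by end_near.
Qed.

End diff_quotient.

(** * Integration of complex functions *)

Section bounded_measurable.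
Context d (T : measurableType d) (R : realType).
Implicit Types (D : set T) (F G : T -> R[i]) (u : R[i]).

(** One condition that gives integrability for every finite measure, hence for the four Jordan parts
    of [mu] and for Lebesgue measure on [[a, b]] alike. *)
Definition bmeas D F := [/\ measurable_fun D (fun x => complex.Re (F x)),
  measurable_fun D (fun x => complex.Im (F x)) &
  exists K, forall x, D x -> Normc.normc (F x) <= K].

Lemma bmeas_cst D u : bmeas D (cst u).
Proof. by split=> //; exists (Normc.normc u). Qed.

Lemma bmeasD D F G : bmeas D F -> bmeas D G -> bmeas D (fun x => F x + G x).
Proof.
move=> [F1 F2 [K FK]] [G1 G2 [L GL]]; split.
- by under eq_fun do rewrite cReD; exact: measurable_funD.
- by under eq_fun do rewrite cImD; exact: measurable_funD.
- exists (K + L) => x Dx; apply: (le_trans (le_normcD _ _)).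
  by apply: lerD; [exact: FK|exact: GL].
Qed.

Lemma bmeasM D F G : bmeas D F -> bmeas D G -> bmeas D (fun x => F x * G x).
Proof.
move=> [F1 F2 [K FK]] [G1 G2 [L GL]]; split.
- under eq_fun do rewrite cReM.
  by apply: measurable_funB; exact: measurable_funM.
- under eq_fun do rewrite cImM.
  by apply: measurable_funD; exact: measurable_funM.
- exists (K * L) => x Dx; rewrite Normc.normcM.
  by apply: ler_pM; rewrite ?normc_ge0//; [exact: FK|exact: GL].
Qed.

Lemma bmeasZ D F u : bmeas D F -> bmeas D (fun x => u * F x).
Proof. by move=> bF; exact: bmeasM (bmeas_cst D u) bF. Qed.

Lemma bmeasN D F : bmeas D F -> bmeas D (fun x => - F x).
Proof.
by move=> bF; under eq_fun do rewrite -mulN1r; exact: bmeasZ.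
Qed.

Lemma eq_bmeas D F G : {in D, F =1 G} -> bmeas D F -> bmeas D G.
Proof.
move=> FG [F1 F2 [K FK]]; split.
- by apply: eq_measurable_fun F1 => x xD; rewrite FG.
- by apply: eq_measurable_fun F2 => x xD; rewrite FG.
- by exists K => x Dx; rewrite -FG ?inE//; exact: FK.
Qed.

Lemma bmeas_sum D (I : Type) (r : seq I) (P : pred I) (F : I -> T -> R[i]) :
  (forall i, P i -> bmeas D (F i)) ->
  bmeas D (fun x => \sum_(i <- r | P i) F i x).
Proof.
move=> bF; elim: r => [|i r IH].
  rewrite (_ : (fun _ => _) = cst 0); first exact: bmeas_cst.
  by apply/funext => x; rewrite big_nil.
have [Pi|nPi] := boolP (P i); last first.
  by apply: eq_bmeas IH => x _; rewrite big_cons (negbTE nPi).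
apply: eq_bmeas (bmeasD (bF i Pi) IH) => x _.
by rewrite big_cons Pi.
Qed.

Lemma bmeas_subset D E F : measurable D -> E `<=` D -> bmeas D F -> bmeas E F.
Proof.
move=> mD ED [F1 F2 [K FK]]; split.
- exact: measurable_funS F1.
- exact: measurable_funS F2.
- by exists K => x /ED; exact: FK.
Qed.

Lemma bmeas_mkcond D F : measurable D -> bmeas D F -> bmeas setT (F \_ D).
Proof.
move=> mD [F1 F2 [K FK]]; split.
- rewrite (_ : (fun x => _) = (fun x => complex.Re (F x)) \_ D).
    by apply/(measurable_restrictT _ mD).
  by apply/funext => x; rewrite !patchE; case: ifP.
- rewrite (_ : (fun x => _) = (fun x => complex.Im (F x)) \_ D).
    by apply/(measurable_restrictT _ mD).
  by apply/funext => x; rewrite !patchE; case: ifP.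
(* On an empty [D] the bound [K] may be negative, whereas the extension takes the value 0. *)
- exists (Num.max K 0) => x _; rewrite patchE; case: ifPn => [|_].
    by rewrite inE => Dx; rewrite le_max FK.
  by rewrite Normc.normc0 le_max lexx orbT.
Qed.

End bounded_measurable.

Section cint.
Context d (T : measurableType d) (R : realType).
Implicit Types (D : set T) (F G : T -> R[i]) (u : R[i]).

Definition cint (nu : {measure set T -> \bar R}) D F : R[i] :=
  (\int[nu]_(x in D) complex.Re (F x)) +i* (\int[nu]_(x in D) complex.Im (F x)).

Lemma eq_cint (nu : {measure set T -> \bar R}) D F G : {in D, F =1 G} ->
  cint nu D F = cint nu D G.
Proof.
by move=> FG; congr (_ +i* _); apply: eq_Rintegral => x xD; rewrite FG.
Qed.

Lemma cint_mkcond (nu : {measure set T -> \bar R}) D F :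
  cint nu D F = cint nu setT (F \_ D).
Proof.
congr (_ +i* _); rewrite Rintegral_mkcond; apply: eq_Rintegral => x _;
  by rewrite !patchE; case: ifP.
Qed.

Lemma cint_ge0 (nu : {measure set T -> \bar R}) D F :
  (forall x, D x -> 0 <= F x) -> 0 <= cint nu D F.
Proof.
move=> F0; rewrite lecE /=; apply/andP; split.
  rewrite (@eq_Rintegral _ _ _ nu D (fun=> 0)).
    by rewrite /Rintegral integral0.
  by move=> x; rewrite inE => /F0; rewrite lecE /= => /andP[/eqP].
by apply: Rintegral_ge0 => x /F0; rewrite lecE /= => /andP[].
Qed.

Variable nu : {finite_measure set T -> \bar R}.
Variables (D : set T) (mD : measurable D).

Lemma finite_measure_lty : (nu D < +oo)%E.
Proof. by rewrite -ge0_fin_numE//; exact: fin_num_measure. Qed.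

Lemma bounded_integrable (f : T -> R) : measurable_fun D f ->
  (exists K, forall x, D x -> `|f x| <= K) -> nu.-integrable D (EFin \o f).
Proof.
move=> mf [K fK]; apply: measurable_bounded_integrable => //.
  exact: finite_measure_lty.
exists K; split; first exact: num_real.
by move=> M KM x Dx /=; apply: (le_trans (fK x Dx)); exact: ltW.
Qed.

Lemma bmeas_Re F : bmeas D F ->
  nu.-integrable D (EFin \o (fun x => complex.Re (F x))).
Proof.
move=> [F1 F2 [K FK]]; apply: bounded_integrable => //; exists K => x Dx.
exact: le_trans (Re_le_normc _) (FK x Dx).
Qed.

Lemma bmeas_Im F : bmeas D F ->
  nu.-integrable D (EFin \o (fun x => complex.Im (F x))).
Proof.
move=> [F1 F2 [K FK]]; apply: bounded_integrable => //; exists K => x Dx.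
exact: le_trans (Im_le_normc _) (FK x Dx).
Qed.

Lemma measurable_normc F : bmeas D F ->
  measurable_fun D (fun x => Normc.normc (F x)).
Proof.
move=> [F1 F2 _]; rewrite (_ : (fun x => _) = (@Num.sqrt R) \o
   (fun x => complex.Re (F x) ^+ 2 + complex.Im (F x) ^+ 2)).
  apply: measurableT_comp;
    first exact: (continuous_measurable_fun (@sqrt_continuous R)).
  by apply: measurable_funD; exact: measurable_funX.
by apply/funext => x /=; case: (F x).
Qed.

Lemma bmeas_normc F : bmeas D F ->
  nu.-integrable D (EFin \o (fun x => Normc.normc (F x))).
Proof.
move=> bF; have [F1 F2 [K FK]] := bF.
apply: bounded_integrable; first exact: measurable_normc.
by exists K => x Dx; rewrite ger0_norm ?normc_ge0//; exact: FK.
Qed.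

Lemma cintD F G : bmeas D F -> bmeas D G ->
  cint nu D (fun x => F x + G x) = cint nu D F + cint nu D G.
Proof.
move=> bF bG; apply: complexP; rewrite ?cReD ?cImD /=.
  rewrite -(RintegralD mD (bmeas_Re bF) (bmeas_Re bG)).
  by apply: eq_Rintegral => x _; rewrite cReD.
rewrite -(RintegralD mD (bmeas_Im bF) (bmeas_Im bG)).
by apply: eq_Rintegral => x _; rewrite cImD.
Qed.

Lemma integrableZl_real (f : T -> R) (k : R) : nu.-integrable D (EFin \o f) ->
  nu.-integrable D (EFin \o (fun x => k * f x)).
Proof.
move=> /(integrableZl mD k); apply: eq_integrable => // x _.
Qed.

Lemma cintZ F u : bmeas D F ->
  cint nu D (fun x => u * F x) = u * cint nu D F.
Proof.
move=> bF; have iR := bmeas_Re bF; have iI := bmeas_Im bF.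
apply: complexP; rewrite ?cReM ?cImM /=.
  rewrite -!(RintegralZl _ mD)// -RintegralB//; try exact: integrableZl_real.
  by apply: eq_Rintegral => x _; rewrite cReM.
rewrite -!(RintegralZl _ mD)// -RintegralD//; try exact: integrableZl_real.
by apply: eq_Rintegral => x _; rewrite cImM.
Qed.

Lemma cintB F G : bmeas D F -> bmeas D G ->
  cint nu D (fun x => F x - G x) = cint nu D F - cint nu D G.
Proof.
move=> bF bG; rewrite cintD//; last exact: bmeasN.
congr (_ + _); rewrite -mulN1r -cintZ//.
by apply: eq_cint => x _; rewrite mulN1r.
Qed.

Lemma Re_cint F : complex.Re (cint nu D F) = \int[nu]_(x in D) complex.Re (F x).
Proof. by []. Qed.

(* Rotating the integral onto the positive axis reduces the inequality to
   the real one, with no loss of constant. *)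
Lemma normc_cint F : bmeas D F ->
  Normc.normc (cint nu D F) <= \int[nu]_(x in D) Normc.normc (F x).
Proof.
move=> bF; set z := cint nu D F.
have [->|z0] := eqVneq z 0.
  rewrite Normc.normc0; apply: Rintegral_ge0 => x _; exact: normc_ge0.
have n0 : 0 < Normc.normc z.
  by rewrite lt_def normc_ge0 andbT;
    apply: contraNneq z0 => /Normc.eq0_normc ->.
rewrite -(ler_pM2l n0) -[leRHS]RintegralZl//; last exact: bmeas_normc.
have -> : Normc.normc z * Normc.normc z = complex.Re (z^*%C * z).
  case: z {n0 z0} => x y /=; rewrite -expr2 sqr_sqrtr ?addr_ge0 ?sqr_ge0//.
  by rewrite mulNr opprK !expr2.
rewrite -cintZ// Re_cint; apply: le_Rintegral => //.
- by apply: bmeas_Re; exact: bmeasZ.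
- by apply: integrableZl_real; exact: bmeas_normc.
- move=> x Dx; apply: (le_trans (ler_norm _));
  apply: (le_trans (Re_le_normc _)).
  by rewrite Normc.normcM; case: (z) => p q /=; rewrite sqrrN.
Qed.

Lemma normc_cint_le F K : bmeas D F -> (forall x, D x -> Normc.normc (F x) <=
  K) ->
  Normc.normc (cint nu D F) <= K * fine (nu D).
Proof.
move=> bF FK; apply: (le_trans (normc_cint bF)).
rewrite -Rintegral_cst//; apply: le_Rintegral => //.
- exact: bmeas_normc.
- by apply: bounded_integrable => //; exists `|K|.
Qed.

End cint.

Section cintegral_cint.
Context d (T : measurableType d) (R : realType).
Variable mu : complex_measure T R.
Implicit Types (D : set T) (F G : T -> R[i]) (u : R[i]).

Definition Re_pos : {finite_measure set T -> \bar R} :=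
  jordan_pos (hahnPN (re_charge mu)).
Definition Re_neg : {finite_measure set T -> \bar R} :=
  jordan_neg (hahnPN (re_charge mu)).
Definition Im_pos : {finite_measure set T -> \bar R} :=
  jordan_pos (hahnPN (im_charge mu)).
Definition Im_neg : {finite_measure set T -> \bar R} :=
  jordan_neg (hahnPN (im_charge mu)).

(** Through this decomposition each property of the complex integral follows by linearity from the
    same property for finite positive measures. *)
Lemma cintegralE D F : cintegral mu D F =
  cint Re_pos D F - cint Re_neg D F + 'i * (cint Im_pos D F - cint Im_neg D F).
Proof.
apply: complexP; rewrite ?cReD ?cImD ?cReM ?cImM ?cReN ?cImN /=
  /cintegral /charge_integral ?cReD ?cImD ?cReN ?cImN /=; ring.
Qed.

Lemma eq_cintegral D F G : {in D, F =1 G} -> cintegral mu D F =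
  cintegral mu D G.
Proof. by move=> FG; rewrite !cintegralE !(eq_cint _ FG). Qed.

Lemma cintegral_mkcond D F : cintegral mu D F = cintegral mu setT (F \_ D).
Proof. by rewrite !cintegralE !(cint_mkcond _ D). Qed.

Variables (D : set T) (mD : measurable D).

Lemma cintegralD F G : bmeas D F -> bmeas D G ->
  cintegral mu D (fun x => F x + G x) = cintegral mu D F + cintegral mu D G.
Proof. by move=> bF bG; rewrite !cintegralE !cintD//; ring. Qed.

Lemma cintegralZ F u : bmeas D F ->
  cintegral mu D (fun x => u * F x) = u * cintegral mu D F.
Proof. by move=> bF; rewrite !cintegralE !cintZ//; ring. Qed.

Lemma cintegral_sum (I : Type) (r : seq I) (P : pred I) (F : I -> T -> R[i]) :
  (forall i, P i -> bmeas D (F i)) ->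
  cintegral mu D (fun x => \sum_(i <- r | P i) F i x) =
  \sum_(i <- r | P i) cintegral mu D (F i).
Proof.
move=> bF; elim: r => [|i r IH].
  rewrite big_nil -[RHS](mul0r (cintegral mu D (cst 0))).
  rewrite -[RHS]cintegralZ; last exact: bmeas_cst.
  by apply: eq_cintegral => x _; rewrite big_nil mul0r.
rewrite [RHS]big_cons; case: ifPn => Pi; last first.
  by rewrite -IH; apply: eq_cintegral => x _; rewrite big_cons (negbTE Pi).
rewrite -IH -cintegralD; [|exact: bF|exact: bmeas_sum].
by apply: eq_cintegral => x _; rewrite big_cons Pi.
Qed.

(** The constant is the total mass on [D] of the four Jordan parts. It is cruder than the total
    variation, but it does not depend on [F], as uniform estimates require. *)
Lemma cintegral_bound : exists2 M, 0 <= M & forall F K, bmeas D F ->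
  (forall x, D x -> Normc.normc (F x) <= K) ->
  Normc.normc (cintegral mu D F) <= M * K.
Proof.
exists (fine (Re_pos D) + fine (Re_neg D) + (fine (Im_pos D) + fine (Im_neg
  D))).
  by rewrite !addr_ge0 ?fine_ge0.
move=> F K bF FK; rewrite cintegralE.
have nB (u v : R[i]) : Normc.normc (u - v) <= Normc.normc u + Normc.normc v.
  by rewrite -[Normc.normc v]normcN; exact: le_normcD.
apply: (le_trans (le_normcD _ _)); rewrite mulrDl; apply: lerD.
  apply: (le_trans (nB _ _)); rewrite mulrDl ![_ * K]mulrC.
  by apply: lerD; exact: normc_cint_le.
have ni : Normc.normc ('i : R[i]) = 1.
  by rewrite /= expr0n add0r expr1n sqrtr1.
rewrite Normc.normcM ni mul1r.
apply: (le_trans (nB _ _)); rewrite mulrDl ![_ * K]mulrC.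
by apply: lerD; exact: normc_cint_le.
Qed.

End cintegral_cint.

(** * Fubini for the Volterra kernel *)

Section fubini.
Context d1 d2 (T1 : measurableType d1) (T2 : measurableType d2) (R : realType).
Variables (nu : {finite_measure set T1 -> \bar R})
  (rho : {finite_measure set T2 -> \bar R}).

Section real.
Variable k : T1 * T2 -> R.
Hypotheses (mk : measurable_fun setT k) (bk : exists K, forall z, `|k z| <= K).

Lemma bounded_integrable_prod : (nu \x rho)%E.-integrable setT (EFin \o k).
Proof.
have [K kK] := bk; apply: measurable_bounded_integrable => //.
  have e : ((nu \x rho) setT = nu setT * rho setT)%E.
    by rewrite -[in LHS]setXTT product_measure1E.
  rewrite [ltLHS]e.
  by apply: lte_mul_pinfty => //;
    [exact: fin_num_measure|exact: finite_measure_lty].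
exists K; split; first exact: num_real.
by move=> M KM x _ /=; apply: (le_trans (kK x)); exact: ltW.
Qed.

Lemma section1_integrable x :
  rho.-integrable setT (EFin \o (fun y => k (x, y))).
Proof.
apply: bounded_integrable => //; first exact: measurableT_comp.
by have [K kK] := bk; exists K.
Qed.

Lemma section2_integrable y : nu.-integrable setT (EFin \o (fun x => k (x, y))).
Proof.
apply: bounded_integrable => //; first exact: measurableT_comp.
by have [K kK] := bk; exists K.
Qed.

Lemma EFin_section1 x :
  (\int[rho]_y k (x, y))%:E = (\int[rho]_y (k (x, y))%:E)%E.
Proof.
rewrite fineK//; exact: (integrable_fin_num measurableT (section1_integrable
  x)).
Qed.

Lemma EFin_section2 y :
  (\int[nu]_x k (x, y))%:E = (\int[nu]_x (k (x, y))%:E)%E.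
Proof.
rewrite fineK//; exact: (integrable_fin_num measurableT (section2_integrable
  y)).
Qed.

Lemma Rintegral_Fubini : \int[nu]_x (\int[rho]_y k (x, y)) =
  \int[rho]_y (\int[nu]_x k (x, y)).
Proof.
rewrite /Rintegral; congr fine.
under eq_integral do rewrite EFin_section1.
under [RHS]eq_integral do rewrite EFin_section2.
exact: (Fubini bounded_integrable_prod).
Qed.

Lemma measurable_section2 : measurable_fun setT (fun y => \int[nu]_x k (x, y)).
Proof.
apply/measurable_EFinP; rewrite (_ : EFin \o _ = fubini_G nu (EFin \o k)).
  exact: measurable_fubini_G bounded_integrable_prod.
by apply/funext => y; rewrite /= EFin_section2.
Qed.

End real.

Variable K : T1 * T2 -> R[i].
Hypothesis bK : bmeas setT K.

Lemma cint_Fubini : cint nu setT (fun x => cint rho setT (fun y => K (x, y))) =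
  cint rho setT (fun y => cint nu setT (fun x => K (x, y))).
Proof.
have [K1 K2 [M KM]] := bK; congr (_ +i* _).
  apply: (Rintegral_Fubini K1); exists M => z.
  exact: le_trans (Re_le_normc _) (KM z I).
apply: (Rintegral_Fubini K2); exists M => z.
exact: le_trans (Im_le_normc _) (KM z I).
Qed.

Lemma bmeas_section2 y : bmeas setT (fun x => K (x, y)).
Proof.
have [K1 K2 [M KM]] := bK; split.
- exact: (measurableT_comp K1).
- exact: (measurableT_comp K2).
- by exists M => x _; exact: KM.
Qed.

Lemma bmeas_cint_section :
  bmeas setT (fun y => cint nu setT (fun x => K (x, y))).
Proof.
have [K1 K2 [M KM]] := bK; split.
- apply: (measurable_section2 K1); exists M => z.
  exact: le_trans (Re_le_normc _) (KM z I).
- apply: (measurable_section2 K2); exists M => z.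
  exact: le_trans (Im_le_normc _) (KM z I).
- exists (M * fine (nu setT)) => y _; apply: normc_cint_le => //.
    exact: bmeas_section2.
  by move=> x _; exact: KM.
Qed.

End fubini.

(** * The Volterra kernel on the triangle and the measurability of [g] *)

Section kernel.
Variable R : realType.
Notation mT := (measurableTypeR R).
Implicit Types (a b : R) (w h : R -> R[i]).

Lemma continuous_bmeas a b h :
  {within `[a, b], continuous (fun x => complex.Re (h x))} ->
  {within `[a, b], continuous (fun x => complex.Im (h x))} ->
  bmeas (`[a, b]%classic : set mT) h.
Proof.
move=> cR cI; split.
- by apply: subspace_continuous_measurable_fun => //; exact: measurable_itv.
- by apply: subspace_continuous_measurable_fun => //; exact: measurable_itv.
- have cab := @segment_compact _ a b.
  have /compact_bounded[M [_ HM]] := continuous_compact cR cab.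
  have /compact_bounded[N [_ HN]] := continuous_compact cI cab.
  exists (`|M| + 1 + (`|N| + 1)) => x abx.
  apply: (le_trans (normc_le_ReIm _)); apply: lerD.
    by apply: HM; [rewrite ltr_pwDr// ler_norm|exists x].
  by apply: HN; [rewrite ltr_pwDr// ler_norm|exists x].
Qed.

Lemma ccts_bmeas a b w : ccts w -> bmeas (`[a, b]%classic : set mT) w.
Proof.
by move=> [cR cI]; apply: continuous_bmeas; exact: continuous_subspaceT.
Qed.

Lemma ccts_comp w (u : R -> R) : continuous u -> ccts w ->
  ccts (fun x => w (u x)).
Proof.
move=> cu [cR cI]; split=> x.
  apply: (@continuous_comp _ _ _ u (fun y => complex.Re (w y)));
    [exact: cu|exact: cR].
apply: (@continuous_comp _ _ _ u (fun y => complex.Im (w y)));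
  [exact: cu|exact: cI].
Qed.

Lemma ccts_shift w t : ccts w -> ccts (fun x => w (x - t)).
Proof.
by apply: ccts_comp => x; apply: cvgB; [exact: cvg_id|exact: cvg_cst].
Qed.

Lemma ccts_refl w t : ccts w -> ccts (fun x => w (t - x)).
Proof.
by apply: ccts_comp => x; apply: cvgB; [exact: cvg_cst|exact: cvg_id].
Qed.

Lemma lebesgue_itv_lty a b :
  (@lebesgue_measure R (`[a, b]%classic : set mT) < +oo)%E.
Proof. by rewrite lebesgue_measure_itv; case: ifPn => // _; exact: ltry. Qed.

(** The restriction is what makes Lebesgue measure finite, so that the results on bounded functions
    apply to it. *)
Definition lebesgue_on a b : {finite_measure set mT -> \bar R} :=
  @mfrestr _ mT R `[a, b]%classic (@lebesgue_measure R)
    (measurable_itv `[a, b]) (lebesgue_itv_lty a b).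

Definition volterra_domain a b : set (mT * mT) :=
  [set z | [&& a <= z.2, z.2 <= z.1 & z.1 <= b]].

Lemma measurable_volterra_domain a b : measurable (volterra_domain a b).
Proof.
have -> : volterra_domain a b =
    ((fun z => a <= z.2) @^-1` [set true] `&` (fun z => z.2 <=
      z.1) @^-1` [set true])
    `&` (fun z => z.1 <= b) @^-1` [set true].
  apply/seteqP; split=> z /=; first by move=> /and3P[-> -> ->].
  by move=> [[? ?] ?]; apply/and3P.
apply: measurableI; [apply: measurableI|].
- by rewrite -[X in measurable X]setTI; apply: measurable_fun_ler.
- by rewrite -[X in measurable X]setTI; apply: measurable_fun_ler.
- by rewrite -[X in measurable X]setTI; apply: measurable_fun_ler.
Qed.

Variables (a b : R) (w : R -> R[i]).
Hypothesis cw : ccts w.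
Let ab : set mT := `[a, b]%classic.
Let mab : measurable ab. Proof. exact: measurable_itv. Qed.

(** Extension by zero off the triangle moves the variable limits of integration into the support:
    its sections live on [[a, x]] for fixed [x] and on [[t, b]] for fixed [t], and Fubini can be
    used on the whole plane. *)
Definition volterra_kernel h : mT * mT -> R[i] :=
  (fun z => w (z.1 - z.2) * h z.2) \_ (volterra_domain a b).

Lemma bmeas_volterra_kernel h : bmeas ab h -> bmeas setT (volterra_kernel h).
Proof.
move=> bh; apply: bmeas_mkcond; first exact: measurable_volterra_domain.
apply: bmeasM.
  (* On the triangle [x - t] lies between 0 and [b - a], so a bound for [w] on that segment
     suffices. *)
  have [mR mI [K wK]] := ccts_bmeas 0 (b - a) cw; have [cR cI] := cw; split.
  - apply: measurable_funTS.
    apply: (@measurableT_comp _ _ _ _ _ _ (fun y : mT => complex.Re (w y))).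
      exact: continuous_measurable_fun.
    exact: measurable_funB.
  - apply: measurable_funTS.
    apply: (@measurableT_comp _ _ _ _ _ _ (fun y : mT => complex.Im (w y))).
      exact: continuous_measurable_fun.
    exact: measurable_funB.
  - exists K => z /and3P[az zz zb]; apply: wK.
    by rewrite /= in_itv /= subr_ge0 zz /=; exact: lerB.
(* Nothing is known of [h] off [[a, b]]; on the triangle it may be replaced by its extension by
   zero. *)
have bh' : bmeas setT (h \_ ab) by exact: bmeas_mkcond.
have bh2 : bmeas (volterra_domain a b) (fun z => (h \_ ab) z.2).
  have [mR mI [K hK]] := bh'; split.
  - apply: measurable_funTS.
    exact: (@measurableT_comp _ _ _ _ _ _ (fun y :
      mT => complex.Re ((h \_ ab) y))).
  - apply: measurable_funTS.
    exact: (@measurableT_comp _ _ _ _ _ _ (fun y :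
      mT => complex.Im ((h \_ ab) y))).
  - by exists K => z _; exact: hK.
apply: eq_bmeas bh2 => z; rewrite inE => /and3P[az zz zb].
by rewrite patchE mem_set// /ab /= in_itv /= az (le_trans zz).
Qed.

Lemma volterra_kernel1 h x : (fun t => volterra_kernel h (x, t)) =
  if x \in ab then (fun t => w (x - t) * h t) \_ `[a, x]%classic else cst 0.
Proof.
apply/funext => t; rewrite /volterra_kernel patchE.
case: ifPn => [|/negP nV].
  rewrite inE => /and3P[/= at_ tx xb].
  rewrite mem_set; last by rewrite /ab /= in_itv /= xb (le_trans at_).
  by rewrite patchE mem_set//= in_itv /= at_ tx.
case: ifPn => //; rewrite inE /ab /= in_itv /= => /andP[ax xb].
rewrite patchE; case: ifPn => // ; rewrite inE /= in_itv /= => /andP[at_ tx].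
by case: nV; rewrite inE /volterra_domain /= at_ tx.
Qed.

Lemma volterra_kernel2 h t : (fun x => volterra_kernel h (x, t)) =
  if t \in ab then (fun x => h t * w (x - t)) \_ `[t, b]%classic else cst 0.
Proof.
apply/funext => x; rewrite /volterra_kernel patchE.
case: ifPn => [|/negP nV].
  rewrite inE => /and3P[/= at_ tx xb].
  rewrite mem_set; last by rewrite /ab /= in_itv /= at_ (le_trans tx).
  by rewrite patchE mem_set 1?mulrC//= in_itv /= tx.
case: ifPn => //; rewrite inE /ab /= in_itv /= => /andP[at_ tb].
rewrite patchE; case: ifPn => // ; rewrite inE /= in_itv /= => /andP[tx xb].
by case: nV; rewrite inE /volterra_domain /= at_ tx.
Qed.

Lemma cint_cst0 (nu : {finite_measure set mT -> \bar R}) (D : set mT) :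
  cint nu D (cst 0) = 0.
Proof.
by rewrite /cint; apply: complexP => /=; rewrite /Rintegral integral0.
Qed.

Variable mu : complex_measure mT R.

Lemma cintegral_volterra_kernel2 h t :
  cintegral mu setT (fun x => volterra_kernel h (x, t)) =
  ((fun t => kernel_fun b mu w t * h t) \_ ab) t.
Proof.
rewrite volterra_kernel2 patchE; case: ifPn => [tab|_].
  rewrite -cintegral_mkcond mulrC cintegralZ//.
  exact: ccts_bmeas (ccts_shift _ cw).
by rewrite cintegralE !cint_cst0; ring.
Qed.

Lemma bmeas_kernel_prod h : bmeas ab h ->
  bmeas setT ((fun t => kernel_fun b mu w t * h t) \_ ab).
Proof.
move=> /bmeas_volterra_kernel bK.
have bs (nu : {finite_measure set mT -> \bar R}) :=
  bmeas_cint_section nu (lebesgue_on a b) bK.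
apply: eq_bmeas (bmeasD (bmeasD (bs (Re_pos mu)) (bmeasN (bs (Re_neg mu))))
  (bmeasZ 'i (bmeasD (bs (Im_pos mu)) (bmeasN (bs (Im_neg mu)))))) => t _.
by rewrite -cintegral_volterra_kernel2 cintegralE.
Qed.

(** The case [h = 1] of the preceding lemma: the measurability of [g] is that of a partial integral
    of a jointly measurable kernel. *)
Lemma bmeas_kernel : bmeas ab (kernel_fun b mu w).
Proof.
apply: eq_bmeas (bmeas_subset _ _ (bmeas_kernel_prod (bmeas_cst ab 1))) => //.
by move=> t tab; rewrite patchE tab mulr1.
Qed.

Lemma cintegral_Fubini h : bmeas ab h ->
  cintegral mu ab
    (fun x => cint (lebesgue_on a b) `[a, x]%classic (fun t => w (x - t) * h
      t)) =
  cint (lebesgue_on a b) ab (fun t => kernel_fun b mu w t * h t).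
Proof.
move=> bh; have bK := bmeas_volterra_kernel bh.
have bs (nu : {finite_measure set mT -> \bar R}) :=
  bmeas_cint_section nu (lebesgue_on a b) bK.
rewrite cintegral_mkcond; transitivity (cintegral mu setT
    (fun x => cint (lebesgue_on a b) setT (fun t => volterra_kernel h (x, t)))).
  apply: eq_cintegral => x _; rewrite volterra_kernel1 patchE.
  by case: ifPn => _; rewrite ?cint_cst0// -cint_mkcond.
(* The order of integration is exchanged for each of the four Jordan parts, and the results are
   recombined inside the integral over [t]. *)
rewrite cintegralE !(cint_Fubini _ _ bK) -!cintB// -cintZ//; last first.
  by apply: bmeasD => //; exact: bmeasN.
rewrite -cintD//; last 2 first.
- by apply: bmeasD => //; exact: bmeasN.
- by apply/bmeasZ/bmeasD => //; exact: bmeasN.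
rewrite [RHS]cint_mkcond; apply: eq_cint => t _.
by rewrite -cintegral_volterra_kernel2 cintegralE.
Qed.

End kernel.

(** * Derivatives of the spectral function *)

Section cexp_bounds.
Variable R : realType.
Implicit Types z : R[i].

Lemma normc_mulr z (s : R) : 0 <= s -> Normc.normc (z * s%:C) =
  Normc.normc z * s.
Proof.
by move=> s0; rewrite Normc.normcM /= expr0n addr0 sqrtr_sqr ger0_norm.
Qed.

Lemma normc_cexp_le z : Normc.normc (cexp z) <= expR (Normc.normc z).
Proof.
by rewrite normc_cexp ler_expR (le_trans (ler_norm _))// Re_le_normc.
Qed.

Lemma normc_scale_le z (s : R) : 0 <= s <= 1 ->
  Normc.normc (z * s%:C) <= Normc.normc z.
Proof.
by move=> /andP[s0 s1]; rewrite normc_mulr// ler_piMr// normc_ge0.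
Qed.

Lemma cexp_sub1 z :
  Normc.normc (cexp z - 1) <= 2 * (Normc.normc z * expR (Normc.normc z)).
Proof.
have := @cder_bound R (fun s => cexp (z * s%:C)) (fun s => z * cexp (z * s%:C))
  (Normc.normc z * expR (Normc.normc z)) (cder_exp z).
rewrite mulr0 mulr1 cexp0; apply => s s01.
rewrite Normc.normcM ler_wpM2l ?normc_ge0//.
by rewrite (le_trans (normc_cexp_le _))// ler_expR normc_scale_le.
Qed.

(** The derivative of [exp(zs) - zs] in [s] is [z (exp(zs) - 1)], to which the first-order bound
    applies. Each of the two uses of [cder_bound] contributes a factor 2. *)
Lemma cexp_sub1z z : Normc.normc (cexp z - 1 - z) <=
  4 * (Normc.normc z ^+ 2 * expR (Normc.normc z)).
Proof.
have dF s : cder (fun s : R => cexp (z * s%:C) - z * s%:C) s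
    (z * (cexp (z * s%:C) - 1)).
  apply: (cder_eq (cderD (cder_exp z s) (cderN (cderZ z (cder_id s))))).
  by rewrite mulr1 mulrBr mulr1.
have := @cder_bound R _ _ (2 * (Normc.normc z ^+ 2 * expR (Normc.normc z))) dF.
set Y := _ ^+ 2 * _ => H; rewrite (_ : 4 * Y = 2 * (2 * Y)); last by ring.
move: H; rewrite !mulr0 !mulr1 cexp0 subr0 addrAC; apply => s s01.
rewrite Normc.normcM /Y expr2 -mulrA mulrCA ler_wpM2l ?normc_ge0//.
rewrite (le_trans (cexp_sub1 _))// ler_wpM2l//.
by rewrite ler_pM ?normc_ge0 ?expR_ge0 ?ler_expR ?normc_scale_le.
Qed.

End cexp_bounds.

Section spectral.
Variable R : realType.
Notation mT := (measurableTypeR R).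
Variables (a b : R) (mu : complex_measure mT R).
Let ab : set mT := `[a, b]%classic.
Let mab : measurable ab. Proof. exact: measurable_itv. Qed.

Lemma cder_bmeas (F G : R -> R[i]) : (forall x, cder F x (G x)) -> bmeas ab F.
Proof. by move=> /cder_continuous; exact: ccts_bmeas. Qed.

Lemma bmeas_real : bmeas ab (fun x : R => x%:C).
Proof. exact: cder_bmeas (@cder_id R). Qed.

Lemma bmeas_exp l : bmeas ab (fun x : R => cexp (l * x%:C)).
Proof. exact: cder_bmeas (cder_exp l). Qed.

Lemma bmeas_expM j l : bmeas ab (fun x : R => x%:C ^+ j * cexp (l * x%:C)).
Proof.
elim: j => [|j IH].
  by apply: eq_bmeas (bmeas_exp l) => x _; rewrite expr0 mul1r.
by apply: eq_bmeas (bmeasM bmeas_real IH) => x _; rewrite exprS mulrA.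
Qed.

Definition spectral_moment j (l : R[i]) :=
  cintegral mu ab (fun x : R => x%:C ^+ j * cexp (l * x%:C)).

(** Differentiation under the integral sign: the error of the difference quotient is the integral of
    [x^j exp(lx) (exp(hx) - 1 - hx) / h] up to sign, whose integrand is O(|h|) uniformly on
    [[a, b]]. *)
Lemma cvg_spectral_moment j l :
  (fun h => h^-1 *: (spectral_moment j (h + l) - spectral_moment j l)) @ 0^'
    --> spectral_moment j.+1 l.
Proof.
have [M M0 HM] := cintegral_bound mu mab.
have [_ _ [K HK]] := bmeas_expM j l.
have [_ _ [X HX]] := bmeas_real.
(* [M] bounds the integral, [K] the factor [x^j exp(lx)], and the rest is the second-order bound at
   [hx] with [|h| <= 1] and [|x| <= X]. Absolute values are taken because [K] and [X] may be
   negative if the interval is empty. *)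
set C := M * (`|K| * (4 * (`|X| ^+ 2 * expR `|X|))).
have C0 : 0 <= C by rewrite !mulr_ge0// expR_ge0.
have bound (h : R[i]) : h != 0 -> Normc.normc h <= 1 -> Normc.normc
    (spectral_moment j.+1 l - h^-1 * (spectral_moment j (h + l) -
      spectral_moment j l))
    <= C * Normc.normc h.
  move=> h0 h1.
  pose F x := x%:C ^+ j * cexp (l * x%:C) *
     - (h^-1 * (cexp (h * x%:C) - 1 - h * x%:C)).
  have bF : bmeas ab F.
    apply: bmeasM; first exact: bmeas_expM.
    apply/bmeasN/bmeasZ/bmeasD; last by apply/bmeasN/bmeasZ/bmeas_real.
    exact: bmeasD (bmeas_exp h) (bmeasN (bmeas_cst _ _)).
  have e : spectral_moment j (h + l) =
      spectral_moment j l + (h * spectral_moment j.+1 l + - h * cintegral mu ab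
        F).
    rewrite /spectral_moment -!cintegralZ//; last exact: bmeas_expM.
    rewrite -!cintegralD//; [|exact: bmeas_expM| |by apply/bmeasZ/bmeas_expM|
      exact: bmeasZ]; last by apply: bmeasD;
        [apply/bmeasZ/bmeas_expM|exact: bmeasZ].
    apply: eq_cintegral => x _; rewrite mulrDl cexpD /F exprS; field.
    exact: h0.
  have -> : spectral_moment j.+1 l -
      h^-1 * (spectral_moment j (h + l) - spectral_moment j l) =
        cintegral mu ab F.
    by rewrite e; field.
  rewrite /C -mulrA; apply: HM => // x abx.
  rewrite /F Normc.normcM normcN [X in _ * X]Normc.normcM Normc.normcV.
  have hx := HX x abx.
  have nx : Normc.normc (h * x%:C) <= Normc.normc h * `|X|.
    by rewrite Normc.normcM ler_wpM2l ?normc_ge0// (le_trans hx)// ler_norm.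
  have hx1 : Normc.normc (h * x%:C) <= `|X|.
    by rewrite (le_trans nx)// ler_piMl.
  have h0' : 0 < Normc.normc h.
    by rewrite lt_def normc_ge0 andbT;
      apply: contraNneq h0 => /Normc.eq0_normc ->.
  rewrite -mulrA ler_pM ?normc_ge0//.
  - by rewrite mulr_ge0 ?invr_ge0 ?normc_ge0.
  - by rewrite (le_trans (HK x abx))// ler_norm.
  rewrite mulrC ler_pdivrMr// (le_trans (cexp_sub1z _))//.
  rewrite -!mulrA ler_wpM2l//.
  have -> : `|X| * (`|X| * (expR `|X| * (Normc.normc h * Normc.normc h))) =
    Normc.normc h * `|X| * ((Normc.normc h * `|X|) * expR `|X|) by ring.
  rewrite ler_pM ?mulr_ge0 ?normc_ge0 ?expR_ge0//.
  by rewrite ler_pM ?normc_ge0 ?expR_ge0 ?ler_expR.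
apply/cvgrPdist_lt => e e0.
have /complex_realP[e' ee'] : e \is Num.real by exact: gtr0_real.
move: e0; rewrite ee' ltcR => e0.
(* [C] itself may be 0, so the tolerance is divided by [C + 1]. *)
have C1 : 0 < C + 1 by rewrite ltr_wpDl.
near=> h.
have h0 : h != 0 by near: h; exact: nbhs_dnbhs_neq.
have h1 : `|h| < 1 by near: h; apply: dnbhs0_lt.
have he : `|h| < (e' / (C + 1))%:C.
  by near: h; apply: dnbhs0_lt; rewrite ltcR divr_gt0.
rewrite normcE_normr ltcR.
apply: (le_lt_trans (bound h h0 _)).
  by move: h1; rewrite normcE_normr -[1]/(1%:C) ltcR => /ltW.
move: he; rewrite normcE_normr ltcR ltr_pdivlMr// mulrDr mulr1 mulrC.
by apply: le_lt_trans; rewrite lerDl normc_ge0.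
Unshelve. all: by end_near.
Qed.

Lemma derive1n_spectral_function j :
  derive1n j (spectral_function a b mu) = spectral_moment j.
Proof.
elim: j => [|j IH].
  apply/funext => l; rewrite derive1n0 /spectral_function /spectral_moment.
  by apply: eq_cintegral => x _; rewrite expr0 mul1r.
rewrite derive1nS IH; apply/funext => l.
exact: (cvg_lim (@norm_hausdorff _ _) (@cvg_spectral_moment j l)).
Qed.

Lemma spectral_moment_eq0 j l :
  (j < zero_multiplicity (spectral_function a b mu) l)%N ->
  spectral_moment j l = 0.
Proof.
(* A chosen value satisfies the vanishing condition by definition; the default value 0 leaves no [j]
   below it. *)
rewrite /zero_multiplicity; case: xgetP => [m -> [vm _]|_];
  last by rewrite ltn0.
by move=> /vm; rewrite derive1n_spectral_function.
Qed.

End spectral.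

(** * Solutions of the homogeneous equation *)

Section polynomial_functions.
Variable R : realType.
Implicit Types (p q : {poly R[i]}) (x : R).

Lemma cder_poly p x :
  cder (fun y => p.[y%:C]) x p^`().[x%:C].
Proof.
elim/poly_ind: p => [|p u IH].
  rewrite deriv0 horner0; apply: cder_ext (cder_cst 0 x) => y.
  by rewrite horner0.
rewrite derivD derivC addr0 derivM derivX mulr1 !hornerE.
apply: (@cder_ext _ (fun y => p.[y%:C] * y%:C + u)).
  by move=> y; rewrite !hornerE.
apply: (cder_eq (cderD (cderM IH (cder_id x)) (cder_cst u x))).
by rewrite mulr1 addr0.
Qed.

Lemma poly_primitive q : {p : {poly R[i]} | p^`() = q & (size p <=
  (size q).+1)%N}.
Proof.
(* At [i = 0] the division by zero returns 0, so this primitive has no constant term. *)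
exists (\poly_(i < (size q).+1) (q`_i.-1 / i%:R)); last exact: size_poly.
apply/polyP => i; rewrite coef_deriv coef_poly ltnS /=.
case: ltnP => [iq|qi]; last by rewrite mul0rn nth_default.
by rewrite -[LHS]mulr_natr divfK// pnatr_eq0.
Qed.

End polynomial_functions.

Section exponential_polynomials.
Variable R : realType.
Notation mT := (measurableTypeR R).
Variables (a b : R) (mu : complex_measure mT R).
Let ab : set mT := `[a, b]%classic.
Let mab : measurable ab. Proof. exact: measurable_itv. Qed.

(* [psi] encodes a smooth function [psi 1] together with the action of constant
   coefficient differential operators: [psi p] is [p(d/dx)] applied to it. *)
Variable psi : {poly R[i]} -> R -> R[i].
Hypothesis psi_linear : forall u p q x, psi (u *: p + q) x =
  u * psi p x + psi q x.
Hypothesis cder_psi : forall p x, cder (psi p) x (psi (p * 'X) x).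

Lemma psiM_root p l x : psi (p * ('X - l%:P)) x = psi (p * 'X) x - l * psi p x.
Proof.
rewrite mulrBr -[p * l%:P]mulrC mul_polyC addrC -scaleNr psi_linear.
by rewrite mulNr addrC.
Qed.

(** Multiplication by [exp(-lx)] turns the operator [d/dx - l] into [d/dx]; each factor removed is
    one integration of a polynomial, which raises its size by at most one. *)
Lemma psi_exp_poly m l p : (forall x, psi (p * ('X - l%:P) ^+ m) x = 0) ->
  exists2 q : {poly R[i]}, (size q <= m)%N &
    forall x, psi p x = q.[x%:C] * cexp (l * x%:C).
Proof.
elim: m p => [|m IH] p p0.
  by exists 0 => [|x]; rewrite ?size_poly0// horner0 mul0r -(p0 x) expr0 mulr1.
have [q sq qE] : exists2 q : {poly R[i]}, (size q <= m)%N &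
    forall x, psi (p * ('X - l%:P)) x = q.[x%:C] * cexp (l * x%:C).
  by apply: IH => x; rewrite -mulrA -exprS.
have [r rq sr] := poly_primitive q.
(* The first term has derivative [q], and [r] is a primitive of [q], so [F] is constant; its value
   [u] is the constant of integration. *)
pose F x := psi p x * cexp (- l * x%:C) - r.[x%:C].
have F0 x : cder F x 0.
  apply: (cder_eq (cderD (cderM (cder_psi p x) (cder_exp (- l) x))
    (cderN (cder_poly r x)))).
  have -> : psi (p * 'X) x = q.[x%:C] * cexp (l * x%:C) + l * psi p x.
    by rewrite -qE psiM_root subrK.
  rewrite rq; have := cexpNK (l * x%:C); rewrite -mulNr => e.
  by rewrite -[X in _ - X]mulr1 -[X in _ - _ * X]e; ring.
move: (F 0) (fun x => esym (cder0_cst 0 x F0)) => u Fu.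
exists (r + u%:P) => [|x].
  rewrite (leq_trans (size_polyD _ _))// geq_max (leq_trans sr)//.
  exact: leq_trans (size_polyC_leq1 _) _.
rewrite !hornerE -(Fu x) /F addrC subrK -mulrA [X in _ * X]mulrC.
by rewrite mulNr cexpNK mulr1.
Qed.

Lemma cintegral_exp_poly (q : {poly R[i]}) l :
  (forall j, (j < size q)%N -> spectral_moment a b mu j l = 0) ->
  cintegral mu ab (fun x : R => q.[x%:C] * cexp (l * x%:C)) = 0.
Proof.
move=> q0; transitivity (cintegral mu ab (fun x : R =>
    \sum_(j < size q) q`_j * (x%:C ^+ j * cexp (l * x%:C)))).
  apply: eq_cintegral => x _; rewrite horner_coef mulr_suml.
  by apply: eq_bigr => j _; rewrite mulrA.
rewrite cintegral_sum//; last by move=> j _; apply/bmeasZ/bmeas_expM.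
rewrite big1// => j _; rewrite cintegralZ//; last exact: bmeas_expM.
by have := q0 j (ltn_ord j); rewrite /spectral_moment => ->; rewrite mulr0.
Qed.

(* Two distinct roots [l] and [v] satisfy ('X - l) - ('X - v) = v - l, so [p] is
   a combination of p ('X - l) and p ('X - v), each annihilated by a product
   with one factor less; only powers of a single ('X - l) remain. *)
Lemma cintegral_psi_eq0 (s : seq R[i]) p :
  (forall l j, (j < count_mem l s)%N -> spectral_moment a b mu j l = 0) ->
  (forall x, psi (p * \prod_(z <- s) ('X - z%:P)) x = 0) ->
  cintegral mu ab (psi p) = 0.
Proof.
(* The induction is on the length, since the lists met below are not in general tails of the given
   one. *)
have [n] := ubnP (size s); elim: n s p => // n IH [|l s] p /= sn s0 p0.
  transitivity (cintegral mu ab (fun x : R => 0%:P.[x%:C] * cexp (0 * x%:C))).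
    by apply: eq_cintegral => x _; rewrite hornerC mul0r -(p0 x) big_nil mulr1.
  by apply: cintegral_exp_poly => j; rewrite size_poly0.
have [sl|] := boolP (all (pred1 l) s).
  have [q sq qE] : exists2 q : {poly R[i]}, (size q <= (size s).+1)%N &
      forall x, psi p x = q.[x%:C] * cexp (l * x%:C).
    apply: psi_exp_poly => x; rewrite -[RHS](p0 x); congr (psi (p * _) x).
    by rewrite big_cons (all_pred1P _ _ sl) big_nseq size_nseq iter_mulr_1
      -exprS.
  transitivity (cintegral mu ab (fun x : R => q.[x%:C] * cexp (l * x%:C))).
    by apply: eq_cintegral => x _; exact: qE.
  apply: cintegral_exp_poly => j jq; apply: s0.
  (* All roots equal [l], so its multiplicity is the full length of the list, which bounds the size
     of [q]. *)
  by rewrite eqxx (eqP (etrans (esym (all_count _ _)) sl)) (leq_trans jq).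
case/allPn => v vs /= vl.
have {vs} svE := perm_to_rem vs; set s' := rem v s in svE.
have vl0 : v - l != 0 by rewrite subr_eq0.
have countE z : count_mem z s = ((v == z) + count_mem z s')%N.
  by have /permP/(_ (pred1 z)) := svE.
have sizeE : size s = (size s').+1 by have /perm_size := svE.
have prodE : \prod_(z <- s) ('X - z%:P) =
  ('X - v%:P) * \prod_(z <- s') ('X - z%:P).
  by rewrite (perm_big _ svE) big_cons.
have Il : cintegral mu ab (psi (p * ('X - l%:P))) = 0.
  (* Dropping a root only lowers multiplicities, so the vanishing of the moments is inherited. *)
  apply: (IH (v :: s')) => [|z j jz|x] /=.
  - by rewrite -sizeE -ltnS.
  - by apply: s0; rewrite countE (leq_trans jz)// leq_addl.
  - by rewrite -[RHS](p0 x) !big_cons prodE !mulrA.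
have Iv : cintegral mu ab (psi (p * ('X - v%:P))) = 0.
  apply: (IH (l :: s')) => [|z j jz|x] /=.
  - by rewrite -sizeE -ltnS.
  - by apply: s0; rewrite countE addnCA (leq_trans jz)// leq_addl.
  - rewrite -[RHS](p0 x) 2!big_cons prodE; congr (psi _ x); ring.
have bpsi q : bmeas ab (psi q) by apply: cder_bmeas => x; exact: cder_psi.
transitivity (cintegral mu ab (fun x => (v - l)^-1 *
    (psi (p * ('X - l%:P)) x + (-1) * psi (p * ('X - v%:P)) x))).
  by apply: eq_cintegral => x _; rewrite !psiM_root; field.
rewrite cintegralZ ?cintegralD ?cintegralZ ?Il ?Iv//.
- by rewrite mulr0 addr0 mulr0.
- exact: bmeasZ.
- by apply: bmeasD => //; exact: bmeasZ.
Qed.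

End exponential_polynomials.

(** * Constant coefficient operators acting on the characteristic solution *)

Section characteristic_solution.
Variable R : realType.
Notation mT := (measurableTypeR R).
Variables (n : nat) (c : 'I_n.+1 -> R[i]) (w : R -> R[i]).
Hypothesis hw : characteristic_solution c w.
Variable P : {poly R[i]}.
Hypotheses (monP : P \is monic) (sizeP : size P = n.+1).
Hypothesis Pc : forall j : 'I_n.+1, P`_j = c j.

Let W i := deriven_on [set: R] i w.

Lemma cder_deriven_on i x : (i < n)%N -> cder (W i) x (W i.+1 x).
Proof.
move=> ilt; have [dw _ _] := hw.
by apply: (diff_quotient_cder filterT); exact: dw.
Qed.

Lemma diff_op_poly x : \sum_(j < n.+1) P`_j * W j x = 0.
Proof.
have [_ /(_ x) dw _] := hw; rewrite -[RHS]dw /diff_op.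
by apply: eq_bigr => j _; rewrite Pc.
Qed.

(* Reducing modulo the characteristic polynomial [P] makes [p(d/dx) w] available
   for every [p] although only [n] derivatives of [w] are known to exist. *)
Definition operator_action (p : {poly R[i]}) (x : R) :=
  \sum_(j < n) (p %% P)`_j * W j x.

Lemma operator_action_linear u p q x : operator_action (u *: p + q) x =
  u * operator_action p x + operator_action q x.
Proof.
rewrite /operator_action modpD modpZl mulr_sumr -big_split/=.
by apply: eq_bigr => j _; rewrite coefD coefZ mulrDl mulrA.
Qed.

Lemma size_modP p : (size (p %% P)%R <= n)%N.
Proof. by rewrite -ltnS -sizeP ltn_modp monic_neq0. Qed.

(* [r 'X] exceeds the degree of a remainder by at most one, so one subtraction
   of a multiple of [P] reduces it. *)
Lemma modp_mulX p : (p * 'X) %% P = (p %% P) * 'X - ((p %% P) * 'X)`_n *: P.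
Proof.
set r := p %% P; set u := _`_n.
have P0 : P != 0 by rewrite monic_neq0.
have su : (size (r * 'X - u *: P)%R <= n)%N.
  apply/leq_sizeP => j; rewrite leq_eqVlt => /predU1P[<-|nj].
    rewrite coefB coefZ -/u -[n]/(n.+1.-1) -sizeP -/(lead_coef P).
    by rewrite (monicP monP) mulr1 subrr.
  rewrite coefB coefZ coefMX; case: j nj => // j nj /=.
  rewrite nth_default ?(leq_trans (size_modP _))//.
  by rewrite [P`_ _]nth_default ?mulr0 ?subr0// sizeP.
rewrite {1}(divp_eq p P) -/r mulrDl mulrAC modpD modp_mull add0r.
rewrite -[X in X %% P](subrK (u *: P)) modpD modpZl modpp scaler0 addr0.
by rewrite modp_small// sizeP ltnS.
Qed.

(** Termwise differentiation replaces the remainder [r] by [r 'X], which may involve [W n].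
    Subtracting a multiple of [P] removes that term and changes nothing, because [P(d/dx) w = 0]. *)
Lemma cder_operator_action p x :
  cder (operator_action p) x (operator_action (p * 'X) x).
Proof.
have D : cder (operator_action p) x (\sum_(j < n) (p %% P)`_j * W j.+1 x).
  by apply: cder_sum => j _; apply: cderZ; exact: cder_deriven_on.
apply: (cder_eq D); rewrite /operator_action modp_mulX; set r := p %% P.
set u := (r * 'X)`_n.
have E : \sum_(j < n.+1) (r * 'X - u *: P)`_j * W j x =
    \sum_(j < n) r`_j * W j.+1 x.
  transitivity (\sum_(j < n.+1) (r * 'X)`_j * W j x -
      u * \sum_(j < n.+1) P`_j * W j x).
    rewrite mulr_sumr -sumrB; apply: eq_bigr => j _.
    by rewrite coefB coefZ mulrBl mulrA.
  rewrite diff_op_poly mulr0 subr0 big_ord_recl coefMX mul0r add0r.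
  by apply: eq_bigr => j _; rewrite coefMX.
rewrite -E big_ord_recr /= coefB coefZ -/u -[X in P`_X]/(n.+1.-1) -sizeP.
by rewrite -/(lead_coef P) (monicP monP) mulr1 subrr mul0r addr0.
Qed.

Lemma operator_action_mulP p x : operator_action (p * P) x = 0.
Proof.
by rewrite /operator_action modp_mull big1// => j _; rewrite coef0 mul0r.
Qed.

Lemma operator_actionXn i x : (i < n)%N -> operator_action 'X^i x = W i x.
Proof.
move=> ilt; rewrite /operator_action modp_small ?size_polyXn ?sizeP//.
rewrite (bigD1 (Ordinal ilt))//= coefXn eqxx mul1r big1 ?addr0// => j ji.
by rewrite coefXn (negbTE (_ : (j : nat) != i)) ?mul0r.
Qed.

Variables (a b : R) (mu : complex_measure mT R).

(** Translation commutes with constant coefficient operators, so the translate of [operator_action]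
    is again an admissible [psi]; the lemma on roots is applied to it at ['X^i]. *)
Lemma cintegral_deriven_shift (s : seq R[i]) i d : (i < n)%N ->
  P = \prod_(z <- s) ('X - z%:P) ->
  (forall l j, (j < count_mem l s)%N -> spectral_moment a b mu j l = 0) ->
  cintegral mu (`[a, b]%classic : set mT) (fun x : R => W i (x - d)) = 0.
Proof.
move=> ilt Ps s0; pose psi p x := operator_action p (x - d).
rewrite -(@cintegral_psi_eq0 _ a b mu psi _ _ s 'X^i)//.
- by apply: eq_cintegral => x _; rewrite /psi operator_actionXn.
- by move=> u p q x; exact: operator_action_linear.
- by move=> p x; apply: cder_shift; exact: cder_operator_action.
- by move=> x; rewrite /psi -Ps operator_action_mulP.
Qed.

End characteristic_solution.

(** * Lagrange identity and variation of constants *)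

Section within_continuity.
Variable R : realType.
Implicit Types (D : set R) (F G : R -> R[i]).

Definition cwithin D F := {within D, continuous (fun x => complex.Re (F x))} /\
  {within D, continuous (fun x => complex.Im (F x))}.

Lemma cwithinD D F G : cwithin D F -> cwithin D G ->
  cwithin D (fun x => F x + G x).
Proof.
move=> [F1 F2] [G1 G2]; split => x.
  under eq_fun do rewrite cReD.
  by apply: cvgD; [exact: F1|exact: G1].
under eq_fun do rewrite cImD.
by apply: cvgD; [exact: F2|exact: G2].
Qed.

Lemma cwithinM D F G : cwithin D F -> cwithin D G ->
  cwithin D (fun x => F x * G x).
Proof.
move=> [F1 F2] [G1 G2]; split => x.
  under eq_fun do rewrite cReM.
  apply: cvgB.
    by apply: cvgM; [exact: F1|exact: G1].
  by apply: cvgM; [exact: F2|exact: G2].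
under eq_fun do rewrite cImM.
apply: cvgD.
  by apply: cvgM; [exact: F1|exact: G2].
by apply: cvgM; [exact: F2|exact: G1].
Qed.

Lemma cwithin_ccts D F : ccts F -> cwithin D F.
Proof. by move=> [? ?]; split; exact: continuous_subspaceT. Qed.

Lemma cwithin_cst D u : cwithin D (cst u : R -> R[i]).
Proof. by apply: cwithin_ccts; split=> x; exact: cvg_cst. Qed.

Lemma cwithin_sum D (I : Type) (r : seq I) (P : pred I) (F : I -> R -> R[i]) :
  (forall i, P i -> cwithin D (F i)) ->
  cwithin D (fun x => \sum_(i <- r | P i) F i x).
Proof.
move=> cF; elim: r => [|i r IH].
  rewrite (_ : (fun _ => _) = cst 0); first exact: cwithin_cst.
  by apply/funext => x; rewrite big_nil.
have [Pi|nPi] := boolP (P i); last first.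
  rewrite (_ : (fun _ => _) = fun x => \sum_(i <- r | P i) F i x)//.
  by apply/funext => x; rewrite big_cons (negbTE nPi).
rewrite (_ : (fun _ => _) = fun x => F i x + \sum_(i <- r | P i) F i x).
  by apply: cwithinD => //; exact: cF.
by apply/funext => x; rewrite big_cons Pi.
Qed.

Lemma cwithin_subset D E F : E `<=` D -> cwithin D F -> cwithin E F.
Proof. by move=> ED [? ?]; split; exact: continuous_subspaceW ED _. Qed.

Lemma cwithinP D F : (forall x, D x -> F @ within D (nbhs x) --> F x) ->
  cwithin D F.
Proof.
move=> cF.
have H (h : R[i] -> R) : (forall u v, h (u - v) = h u - h v) ->
    (forall u, `|h u| <= Normc.normc u) ->
    {within D, continuous (fun y => h (F y))}.
  move=> hB hle; apply/subspace_continuousP => x Dx.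
  apply/cvgrPdist_lt => e e0; have /cvgrPdist_lt := cF x Dx.
  have e0' : 0 < e%:C :> R[i] by rewrite ltcR.
  move=> /(_ _ e0'); apply: filterS => y.
  by rewrite -hB normcE_normr ltcR; apply: le_lt_trans.
split; apply: H.
- by move=> u v; rewrite cReD cReN.
- exact: Re_le_normc.
- by move=> u v; rewrite cImD cImN.
- exact: Im_le_normc.
Qed.

Lemma cwithin_bmeas a b F : cwithin `[a, b] F ->
  bmeas (`[a, b]%classic : set (measurableTypeR R)) F.
Proof. by move=> [? ?]; exact: continuous_bmeas. Qed.

(** Differentiability is asked for on the open interval only, since at [a] and [b] the derivatives
    of [f] are one-sided. *)
Lemma Rintegral_FTC2 a b x (f F : R -> R) : a <= x <= b ->
  {within `[a, x], continuous f} -> {within `[a, x], continuous F} ->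
  (forall t, a < t < x -> is_derive t 1 F (f t)) ->
  \int[lebesgue_on a b]_(t in `[a, x]) f t = F x - F a.
Proof.
move=> /andP[ax xb] cf cF dF.
have -> : \int[lebesgue_on a b]_(t in `[a, x]) f t =
    \int[@lebesgue_measure R]_(t in `[a, x]) f t.
  congr fine; apply: eq_measure_integral => A mA Aax.
  transitivity (@lebesgue_measure R (A `&` `[a, b]%classic)) => //.
  rewrite setIidl// => t /Aax /=.
  by rewrite !in_itv /= => /andP[-> tx]; exact: le_trans xb.
(* For [x = a] the integral over a point and the increment both vanish. *)
move: ax; rewrite le_eqVlt => /predU1P[<-|ax].
  by rewrite set_itv1 Rintegral_set1 subrr.
have /(continuous_within_itvP _ ax)[_ ca cx] := cF.
rewrite /Rintegral (continuous_FTC2 ax cf (F := F))//.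
- split=> // t; rewrite in_itv /= => tax.
  by have [] := dF t tax.
- move=> t; rewrite in_itv /= => tax.
  by rewrite derive1E; have [] := dF t tax.
Qed.

Lemma cint_FTC2 a b x F G : a <= x <= b ->
  cwithin `[a, x] F -> cwithin `[a, x] G ->
  (forall t, a < t < x -> cder F t (G t)) ->
  cint (lebesgue_on a b) `[a, x]%classic G = F x - F a.
Proof.
move=> axb [F1 F2] [G1 G2] dF; apply: complexP;
  rewrite ?cReD ?cImD ?cReN ?cImN /=.
  by apply: (Rintegral_FTC2 axb G1 F1) => t /dF[].
by apply: (Rintegral_FTC2 axb G2 F2) => t /dF[].
Qed.

End within_continuity.

Section lagrange_identity.
Variable R : realType.
Variables (n : nat) (c : 'I_n.+1 -> R[i]) (W F : nat -> R -> R[i]) (x : R).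

(** This is [B_x(t)]. The sequences [W] and [F] are abstract because the derivatives of [w] are
    taken on the whole line and those of [f] relative to [[a, b]]. *)
Definition bilinear_concomitant (t : R) :=
  \sum_(j < n.+1) c j * \sum_(i < j) W i (x - t) * F (j - i.+1)%N t.

Hypothesis dW : forall i y, (i < n)%N -> cder (W i) y (W i.+1 y).

(** For each [j] the derivative of the inner sum telescopes: the reflection [x - t] gives [W i] a
    minus sign, so consecutive terms cancel and only [W_0 F_j - W_j F_0] is left. *)
Lemma cder_bilinear_concomitant t :
  (forall i, (i < n)%N -> cder (F i) t (F i.+1 t)) ->
  cder bilinear_concomitant t
    (W 0%N (x - t) * (\sum_(j < n.+1) c j * F j t) -
     (\sum_(j < n.+1) c j * W j (x - t)) * F 0%N t).
Proof.
move=> dF; rewrite mulr_sumr mulr_suml -sumrB.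
apply: cder_sum => j _; have jn : (j <= n)%N by rewrite -ltnS.
rewrite (_ : _ - _ = c j * (W 0%N (x - t) * F j t - W j (x - t) * F 0%N t));
  last by ring.
apply: cderZ.
apply: (@cder_eq _ _ _ (\sum_(i < j)
    (- W i.+1 (x - t) * F (j - i.+1)%N t + W i (x - t) * F (j - i)%N t))).
  apply: cder_sum => i _.
  have ij := ltn_ord i; have lt_in : (i < n)%N := leq_trans ij jn.
  apply: cderM; first by apply: cder_refl; exact: dW.
  rewrite -(subnSK ij); apply: dF.
  by rewrite (leq_trans _ jn)// ltn_subrL (leq_ltn_trans _ ij).
pose T i := - (W i (x - t) * F (j - i)%N t).
rewrite -(big_mkord xpredT (fun i =>
  - W i.+1 (x - t) * F (j - i.+1)%N t + W i (x - t) * F (j - i)%N t)).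
rewrite (eq_bigr (fun i => T i.+1 - T i)); last by move=> i _;
  rewrite /T opprK mulNr.
by rewrite telescope_sumr// /T subn0 subnn opprK addrC.
Qed.

(** Only [i = n - 1] has a nonzero initial value, and [i < j <= n] then forces [j = n]; the
    surviving term carries [F] at order 0. *)
Lemma bilinear_concomitant_diag : (0 < n)%N -> c ord_max = 1 ->
  (forall i, (i < n)%N -> W i 0 = (i == n.-1)%:R) ->
  bilinear_concomitant x = F 0%N x.
Proof.
move=> n0 c1 W0; rewrite /bilinear_concomitant big_ord_recr /= c1 mul1r subrr.
rewrite big1 ?add0r => [|j _]; last first.
  rewrite big1 ?mulr0// => i _; have := ltn_ord j; have :=
    ltn_ord i => /= ij jn.
  rewrite W0 ?(ltn_trans ij)// ltn_eqF ?mul0r//.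
  by rewrite -ltnS prednK// (leq_ltn_trans ij).
have H : (n.-1 < n)%N by rewrite prednK.
rewrite (bigD1 (Ordinal H))//= W0// eqxx mul1r prednK// subnn big1 ?addr0// =>
  i ij.
by rewrite W0// (_ : _ == _ = false) ?mul0r//; apply: contraNF ij => /eqP e;
  apply/eqP/val_inj.
Qed.

End lagrange_identity.

(** * Integral representation of the functional *)

Section representation.
Variable R : realType.
Notation mT := (measurableTypeR R).
Variables (a b : R) (mu : complex_measure mT R).
Variables (n : nat) (c : 'I_n.+1 -> R[i]) (w f : R -> R[i]).
Let ab : set mT := `[a, b]%classic.
Let mab : measurable ab. Proof. exact: measurable_itv. Qed.
Hypotheses (hw : characteristic_solution c w) (hf : Cn_on `[a, b]%classic n f).
Hypotheses (n_gt0 : (0 < n)%N) (c_max : c ord_max = 1).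

Let F i := deriven_on `[a, b]%classic i f.
Let W i := deriven_on [set: R] i w.
Let Dcf := diff_op `[a, b]%classic c f.

Lemma cwithin_deriven_on i : (i <= n)%N -> cwithin `[a, b] (F i).
Proof.
have [df cf] := hf; rewrite leq_eqVlt => /predU1P[->|ilt];
  apply: cwithinP => x abx.
  by move/subspace_continuousP : cf; apply.
exact: (diff_quotient_continuous (cvg_derive_on (df i ilt x abx))).
Qed.

Lemma cwithin_diff_op : cwithin `[a, b] Dcf.
Proof.
apply: cwithin_sum => j _; apply: cwithinM; first exact: cwithin_cst.
by apply: cwithin_deriven_on; rewrite -ltnS.
Qed.

Lemma cder_itv_deriven_on i t : (i < n)%N -> a < t < b ->
  cder (F i) t (F i.+1 t).
Proof.
have [df _] := hf; move=> ilt atb.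
apply: (@diff_quotient_cder _ `[a, b]%classic).
  apply: (@filterS _ _ _ `]a, b[%classic); last first.
    by apply: near_in_itvoo; rewrite in_itv.
  exact: subset_itv_oo_cc.
apply: cvg_derive_on; apply: df => //=.
by move: atb => /andP[/ltW ? /ltW ?]; rewrite in_itv; apply/andP.
Qed.

Lemma ccts_characteristic_solution : ccts w.
Proof.
by apply: (@cder_continuous _ w (W 1)) => x;
  exact: (cder_deriven_on hw x n_gt0).
Qed.

(* Variation of constants at [a]: the difference is the solution of the
   homogeneous equation with the same initial values as [f]. *)
Lemma variation_of_constants x : a <= x <= b ->
  cint (lebesgue_on a b) `[a, x]%classic (fun t => w (x - t) * Dcf t) =
  f x - bilinear_concomitant c W F x a.
Proof.
move=> axb; have /andP[ax xb] := axb.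
have dW i y : (i < n)%N ->
  cder (W i) y (W i.+1 y) by exact: (cder_deriven_on hw).
have <- : bilinear_concomitant c W F x x = f x.
  by apply: bilinear_concomitant_diag => //; case: hw.
have sub : `[a, x] `<=` `[a, b] by apply: subset_itvl; rewrite bnd_simp.
have crefl G : ccts G -> cwithin `[a, x] (fun t => G (x - t)).
  by move=> cG; apply: cwithin_ccts; exact: ccts_refl.
apply: cint_FTC2 => //.
- apply: cwithin_sum => j _; apply: cwithinM; first exact: cwithin_cst.
  apply: cwithin_sum => i _.
  have ij := ltn_ord i; have jn : (j <= n)%N by rewrite -ltnS.
  apply: cwithinM.
    apply: crefl; apply: (@cder_continuous _ (W i) (W i.+1)) => y.
    by apply: dW; exact: leq_trans jn.
  apply: cwithin_subset sub _; apply: cwithin_deriven_on.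
  by rewrite (leq_trans _ jn)// leq_subr.
- apply: cwithinM; first by apply: crefl; exact: ccts_characteristic_solution.
  exact: cwithin_subset sub cwithin_diff_op.
- move=> t /andP[at_ tx].
  apply: (cder_eq (cder_bilinear_concomitant c x dW _)).
    move=> i ilt; apply: cder_itv_deriven_on => //.
    by rewrite at_ (lt_le_trans tx).
  (* The second term of the Lagrange identity vanishes because [w] solves the homogeneous
     equation. *)
  have [_ dw _] := hw; have := dw (x - t); rewrite /diff_op => ->.
  by rewrite mul0r subr0.
Qed.

Lemma cintegral_representation :
  (forall i d, (i < n)%N -> cintegral mu ab (fun x : R => W i (x - d)) = 0) ->
  cintegral mu ab f =
  cint (lebesgue_on a b) ab (fun t => kernel_fun b mu w t * Dcf t).
Proof.
move=> W0; have cw := ccts_characteristic_solution.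
rewrite -(cintegral_Fubini cw mu (cwithin_bmeas cwithin_diff_op)).
(* After Fubini the inner integral is [f x] minus the concomitant at [a]; what remains is that the
   latter integrates to 0. *)
rewrite [RHS](@eq_cintegral _ _ _ mu ab _
  (fun x => f x + (-1) * bilinear_concomitant c W F x a)); last first.
  by move=> x; rewrite inE => abx; rewrite variation_of_constants// mulN1r.
have bW j (i : 'I_(nat_of_ord j)) : (j <= n)%N ->
    bmeas ab (fun x : R => W i (x - a) * F (j - i.+1)%N a).
  move=> jn; apply: bmeasM; last exact: bmeas_cst.
  apply: ccts_bmeas; apply: ccts_shift.
  apply: (@cder_continuous _ (W i) (W i.+1)) => y; apply: (cder_deriven_on hw).
  exact: leq_trans jn.
have bB : bmeas ab (fun x => bilinear_concomitant c W F x a).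
  apply: bmeas_sum => j _; apply: bmeasZ; apply: bmeas_sum => i _.
  by apply: bW; rewrite -ltnS.
rewrite cintegralD//;
  [|exact: (cwithin_bmeas (cwithin_deriven_on (leq0n n)))|exact: bmeasZ].
rewrite cintegralZ// (_ :
  cintegral mu ab (fun x => bilinear_concomitant c W F x a) = 0)
  ?mulr0 ?addr0//.
rewrite cintegral_sum//; last first.
  move=> j _; apply: bmeasZ; apply: bmeas_sum => i _.
  by apply: bW; rewrite -ltnS.
apply: big1 => j _; rewrite cintegralZ//; last first.
  by apply: bmeas_sum => i _; apply: bW; rewrite -ltnS.
rewrite cintegral_sum//; last by move=> i _; apply: bW; rewrite -ltnS.
rewrite big1 ?mulr0// => i _.
have lt_in : (i < n)%N by apply: leq_trans (ltn_ord i) _; rewrite -ltnS.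
(* At [t = a] the factor coming from [f] is a constant, so each term is a multiple of an integral
   covered by [W0]. *)
rewrite (@eq_cintegral _ _ _ mu ab _ (fun x :
  R => F (j - i.+1)%N a * W i (x - a)))//.
  rewrite cintegralZ ?W0 ?mulr0//.
  apply: ccts_bmeas; apply: ccts_shift.
  apply: (@cder_continuous _ (W i) (W i.+1)) => y; exact: (cder_deriven_on hw).
by move=> x _; rewrite mulrC.
Qed.

End representation.

(** * Hoelder's inequality *)

Section Lnorm.
Context d (T : measurableType d) (R : realType).
Variable nu : {measure set T -> \bar R}.
Local Open Scope ereal_scope.

(* No measurability is assumed here and in [le_Lnorm], because the functions of
   the theorem are arbitrary outside [`[a, b]]. *)
Lemma ge0_le_integral_nonmeasurable (f g : T -> \bar R) :
  (forall x, 0 <= f x) -> (forall x, f x <= g x) ->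
  \int[nu]_x f x <= \int[nu]_x g x.
Proof.
move=> f0 fg; have g0 x : 0 <= g x by exact: le_trans (fg x).
rewrite !ge0_integralE// !patch_setT; apply: ereal_sup_le => _ [h hf <-].
by exists h => // x; exact: le_trans (fg x).
Qed.

Lemma le_Lnorm p (f g : T -> \bar R) : 0 < p ->
  (forall x, `|f x| <= `|g x|) -> Lnorm nu p f <= Lnorm nu p g.
Proof.
move=> p0 fg; rewrite unlock; case: p p0 => [r|_|//].
- rewrite lte_fin => r0; apply: gt0_ler_poweR.
  + by rewrite invr_ge0 ltW.
  + by rewrite in_itv /= leey andbT integral_ge0// => x _; exact: poweR_ge0.
  + by rewrite in_itv /= leey andbT integral_ge0// => x _; exact: poweR_ge0.
  apply: ge0_le_integral_nonmeasurable => x; first exact: poweR_ge0.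
  apply: gt0_ler_poweR => //; first exact: ltW.
    by rewrite in_itv /= abse_ge0 leey.
  by rewrite in_itv /= abse_ge0 leey.
- by case: ifP => // _; apply: le_ess_sup; exact: aeW.
Qed.

Lemma hoelder_infty (f g : T -> R) : 0 < nu setT ->
  measurable_fun setT f -> measurable_fun setT g ->
  (exists K, forall x, (`|g x| <= K)%R) ->
  Lnorm nu 1 (EFin \o (f \* g)%R) <=
    Lnorm nu 1 (EFin \o f) * Lnorm nu +oo (EFin \o g).
Proof.
move=> nu0 mf mg [K gK]; set S := ess_sup nu (abse \o (EFin \o g)).
(* The norm at [+oo] is the essential supremum only for a measure of positive mass. *)
have -> : Lnorm nu +oo (EFin \o g) = S by rewrite unlock nu0.
rewrite !Lnorm1.
have S0 : 0 <= S by apply: ess_sup_gee => //; apply: aeW => x; exact: abse_ge0.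
(* The bound on [g] makes its essential supremum finite, so that it leaves the integral as a real
   factor. *)
have SK : S <= K%:E by apply/ess_supP; apply: aeW => x; rewrite lee_fin.
have fS : S \is a fin_num by rewrite ge0_fin_numE// (le_lt_trans SK)// ltry.
rewrite -(fineK fS) -ge0_integralZr//; last 2 first.
- by apply: measurableT_comp => //; exact/measurable_EFinP.
- by rewrite lee_fin fine_ge0.
apply: ae_ge0_le_integral => //.
- apply: measurableT_comp => //; apply/measurable_EFinP; exact: measurable_funM.
- by move=> x _; rewrite mule_ge0// lee_fin fine_ge0.
- apply: emeasurable_funM; last exact: measurable_cst.
  by apply: measurableT_comp => //; exact/measurable_EFinP.
- apply: filterS (ess_sup_ge nu (abse \o (EFin \o g))) => x /= gx _.
  by rewrite normrM EFinM lee_wpmul2l ?lee_fin// -lee_fin (le_trans gx)// fineK.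
Qed.

Lemma hoelder_bounded (f g : T -> R) (p q : \bar R) : 0 < nu setT ->
  measurable_fun setT f -> measurable_fun setT g ->
  (exists K, forall x, (`|f x| <= K)%R) -> (exists K, forall x, (`|g x| <=
    K)%R) ->
  1 <= p -> 1 <= q -> p^-1 + q^-1 = 1 ->
  Lnorm nu 1 (EFin \o (f \* g)%R) <=
    Lnorm nu p (EFin \o f) * Lnorm nu q (EFin \o g).
Proof.
(* An infinite exponent forces the other one to be 1, and two infinite exponents would give
   [0 = 1]. *)
move=> nu0 mf mg bf bg; case: p q => [p||] [q||]//.
- rewrite !lee_fin => p1 q1; rewrite !inver !gt_eqF ?(lt_le_trans ltr01)//.
  by move=> [pq]; apply: hoelder => //; exact: lt_le_trans ltr01 _.
- move=> p1 _; rewrite invey adde0 => /eqP; rewrite inve_eq1 => /eqP ->.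
  exact: hoelder_infty.
- move=> _ q1; rewrite invey add0e => /eqP; rewrite inve_eq1 => /eqP ->.
  rewrite muleC (_ : (f \* g)%R = (g \* f)%R); first exact: hoelder_infty.
  by apply/funext => x; rewrite /= mulrC.
- by move=> _ _; rewrite invey adde0 => /eqP; rewrite eq_sym onee_eq0.
Qed.

End Lnorm.

Section hoelder_itv.
Variable R : realType.
Notation mT := (measurableTypeR R).
Variables (a b : R) (g h : R -> R[i]).
Let ab : set mT := `[a, b]%classic.
Let mab : measurable ab. Proof. exact: measurable_itv. Qed.
Hypotheses (bg : bmeas ab g) (bh : bmeas ab h).

(** Both functions are cut off outside [[a, b]] to become globally bounded and measurable. The
    cut-off does not increase the modulus, so monotonicity of the norms leads back to the original
    functions. *)
Lemma cint_hoelder (p q : \bar R) : a < b -> (1 <= p)%E -> (1 <= q)%E ->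
  (p^-1 + q^-1 = 1)%E ->
  ((Normc.normc (cint (lebesgue_on a b) ab (fun t => g t * h t)))%:E <=
    Lnorm_itv a b p h * Lnorm_itv a b q g)%E.
Proof.
move=> ltab p1 q1 pq; set rho := lebesgue_on a b.
have bg' : bmeas setT (g \_ ab) by exact: bmeas_mkcond.
have bh' : bmeas setT (h \_ ab) by exact: bmeas_mkcond.
pose G x := Normc.normc ((g \_ ab) x); pose H x := Normc.normc ((h \_ ab) x).
have -> : cint rho ab (fun t => g t * h t) =
    cint rho setT (fun t => (g \_ ab) t * (h \_ ab) t).
  rewrite cint_mkcond; apply: eq_cint => t _; rewrite !patchE.
  by case: ifP; rewrite ?mul0r.
have rho0 : (0 < rho setT)%E.
  have -> : rho setT = (@lebesgue_measure R (setT `&` `[a, b]%classic)) by [].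
  by rewrite setTI lebesgue_measure_itv /= lte_fin ltab -EFinB lte_fin subr_gt0.
have bounded (F : R -> R[i]) : bmeas (setT : set mT) (F \_ ab) ->
    exists K, forall x, `|Normc.normc ((F \_ ab) x)| <= K.
  by move=> [_ _ [K FK]]; exists K => x; rewrite ger0_norm ?normc_ge0// FK.
apply: (@le_trans _ _ (Lnorm rho 1 (EFin \o (H \* G)))).
  have bF := bmeasM bg' bh'.
  apply: (@le_trans _ _ (\int[rho]_x Normc.normc ((g \_ ab) x * (h \_ ab)
    x))%:E).
    by rewrite lee_fin normc_cint.
  rewrite Lnorm1 fineK.
    rewrite le_eqVlt; apply/orP; left; apply/eqP; apply: eq_integral => x _ /=.
    by rewrite Normc.normcM ger0_norm ?mulr_ge0 ?normc_ge0// mulrC.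
  exact: (integrable_fin_num measurableT (bmeas_normc rho measurableT bF)).
apply: (le_trans (hoelder_bounded rho0 _ _ (bounded _ bh') (bounded _ bg') p1
  q1 pq)).
- exact: (measurable_normc bh').
- exact: (measurable_normc bg').
have norm_patch (F : R -> R[i]) x :
    `|Normc.normc ((F \_ ab) x)| <= `|Normc.normc (F x)|.
  by rewrite patchE; case: ifP => // _; rewrite Normc.normc0 normr0.
apply: lee_pmul; rewrite ?Lnorm_ge0//; apply: le_Lnorm.
- exact: lt_le_trans p1.
- by move=> x; rewrite lee_fin.
- exact: lt_le_trans q1.
- by move=> x; rewrite lee_fin.
Qed.

End hoelder_itv.

(** * The characteristic polynomial and its roots with multiplicity *)

Section characteristic_polynomial.
Variable R : realType.

(** In characteristic 0 the integers below the size of [p - q] are distinct, and they are too many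
    roots for a nonzero difference. *)
Lemma horner_inj (p q : {poly R[i]}) : (forall z, p.[z] = q.[z]) -> p = q.
Proof.
move=> pq; apply/eqP; rewrite -subr_eq0; apply: contraT => pq0.
pose rs : seq R[i] := [seq i%:R | i <- iota 0 (size (p - q)%R)].
have := @max_poly_roots _ (p - q) rs pq0.
rewrite size_map size_iota ltnn; apply.
  by apply/allP => z _; rewrite /root !hornerE pq subrr.
by rewrite map_inj_uniq ?iota_uniq//; exact: mulrIn (oner_neq0 _).
Qed.

Variables (k : nat) (l : 'I_k -> R[i]) (m : 'I_k -> nat).

(** Listing each root as often as its multiplicity gives the shape required by the induction on
    roots, with [count_mem] as multiplicity. *)
Definition root_multiset : seq R[i] :=
  flatten [seq nseq (m i) (l i) | i <- index_enum 'I_k].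

Lemma size_root_multiset : size root_multiset = (\sum_(i < k) m i)%N.
Proof.
rewrite size_flatten /shape -map_comp sumnE big_map.
by apply: eq_bigr => i _; rewrite /= size_nseq.
Qed.

Lemma prod_root_multiset (F : R[i] -> {poly R[i]}) :
  \prod_(z <- root_multiset) F z = \prod_(i < k) F (l i) ^+ m i.
Proof.
rewrite big_flatten big_map; apply: eq_bigr => i _.
by rewrite big_nseq iter_mulr_1.
Qed.

(** Injectivity of [l] keeps the multiplicities of different indices from adding up at the same
    root. *)
Lemma count_root_multiset z : injective l ->
  (0 < count_mem z root_multiset)%N ->
  exists2 i, z = l i & count_mem z root_multiset = m i.
Proof.
move=> l_inj; rewrite count_flatten -map_comp sumnE big_map.
under eq_bigr do rewrite /= count_nseq /=.
move=> s_gt0; have /existsP[i /eqP zi] : [exists i, l i == z].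
  apply: contraTT s_gt0 => /existsPn lz; rewrite big1// => i _.
  by rewrite (negbTE (lz i)).
exists i => //; rewrite (bigD1 i)//= -zi eqxx mul1n big1 ?addn0// => j ji.
by rewrite (inj_eq l_inj) (negbTE ji).
Qed.

Variables (n : nat) (c : 'I_n.+1 -> R[i]).
Hypothesis hn : n = (\sum_(i < k) m i)%N.
Hypothesis hc : forall z : R[i],
  \prod_(i < k) (z - l i) ^+ m i = \sum_(j < n.+1) c j * z ^+ j.

Definition char_polynomial : {poly R[i]} :=
  \prod_(z <- root_multiset) ('X - z%:P).

Lemma size_char_polynomial : size char_polynomial = n.+1.
Proof. by rewrite size_prod_XsubC size_root_multiset hn. Qed.

Lemma coef_char_polynomial (j : 'I_n.+1) : char_polynomial`_j = c j.
Proof.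
have -> : char_polynomial = \poly_(i < n.+1) c (inord i).
  apply: horner_inj => z;
    rewrite /char_polynomial prod_root_multiset horner_prod.
  transitivity (\prod_(i < k) (z - l i) ^+ m i).
    by apply: eq_bigr => i _; rewrite horner_exp hornerXsubC.
  by rewrite hc horner_poly; apply: eq_bigr => i _; rewrite inord_val.
by rewrite coef_poly ltn_ord inord_val.
Qed.

End characteristic_polynomial.

Theorem corollary3p3 (R : realType) (a b : R) (hab : a < b)
  (mu : complex_measure (measurableTypeR R) R)
  (hmu : carried_by_itv a b mu)
  (hmu_neq0 : exists A : set (measurableTypeR R), measurable A /\ mu A <> 0)
  (k : nat) (hk : (0 < k)%N)
  (l : 'I_k -> R[i]) (hl : forall i, spectral_set a b mu (l i))
  (hl_distinct : injective l)
  (m : 'I_k -> nat) (hm_gt0 : forall i, (0 < m i)%N)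
  (hm : forall i, (m i <= zero_multiplicity (spectral_function a b mu) (l i))%N)
  (n : nat) (hn : n = (\sum_(i < k) m i)%N)
  (c : 'I_n.+1 -> R[i])
  (hc : forall z : R[i],
    \prod_(i < k) (z - l i) ^+ m i = \sum_(j < n.+1) c j * z ^+ j)
  (w : R -> R[i]) (hw : characteristic_solution c w) :
  let ab : set R := `[a, b]%classic in
  let Dc := diff_op ab c in
  let g := kernel_fun b mu w in
  let calA (f : R -> R[i]) := cintegral mu ab f in
  [/\ (forall f : R -> R[i], Cn_on ab n f ->
        forall p q : \bar R, (1 <= p)%E -> (1 <= q)%E ->
          (p^-1 + q^-1 = 1)%E ->
          ((Normc.normc (calA f))%:E
             <= Lnorm_itv a b p (Dc f) * Lnorm_itv a b q g)%E),
      ((forall j, c j \is Num.real) ->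
       (forall A : set (measurableTypeR R), measurable A ->
          mu A \is Num.real) ->
       forall f : R -> R[i], Cn_on ab n f ->
         (forall x, ab x -> f x \is Num.real) ->
         ((forall t, ab t -> 0 <= g t) /\ (forall t, ab t -> 0 <= Dc f t)) \/
         ((forall t, ab t -> g t <= 0) /\ (forall t, ab t -> Dc f t <= 0)) ->
         0 <= calA f) &
      ((forall j, c j \is Num.real) ->
       (forall A : set (measurableTypeR R), measurable A ->
          mu A \is Num.real) ->
       forall f : R -> R[i], Cn_on ab n f ->
         (forall x, ab x -> f x \is Num.real) ->
         ((forall t, ab t -> 0 <= g t) /\ (forall t, ab t -> Dc f t <= 0)) \/
         ((forall t, ab t -> g t <= 0) /\ (forall t, ab t -> 0 <= Dc f t)) ->
         calA f <= 0)].

Proof.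
move=> ab Dc g calA.
(* An element counted in the list is some [l i] with count [m i], which is at most its multiplicity
   as a zero of the spectral function. *)
have s0 z j : (j < count_mem z (root_multiset l m))%N ->
  spectral_moment a b mu j z = 0.
  move=> jz; have [i zi mi] :=
    count_root_multiset hl_distinct (leq_ltn_trans (leq0n j) jz).
  by apply: spectral_moment_eq0; rewrite zi (leq_trans _ (hm i))// -mi.
have n_gt0 : (0 < n)%N.
  by rewrite hn (bigD1 (Ordinal hk))//= ltn_addr.
have monP := monic_prod_XsubC (root_multiset l m) xpredT id.
have sizeP := size_char_polynomial l hn.
have Pc := coef_char_polynomial hc.
(* The product of the linear factors is monic; this normalizes the concomitant on the diagonal. *)
have c_max : c ord_max = 1.
  by rewrite -Pc /= -[n]/(n.+1.-1) -sizeP -/(lead_coef _) (monicP monP).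
have W0 i d : (i < n)%N ->
    cintegral mu ab (fun x : R => deriven_on [set: R] i w (x - d)) = 0.
  by move=> ilt; exact: (cintegral_deriven_shift hw monP sizeP Pc d ilt erefl
    s0).
have cw := ccts_characteristic_solution hw n_gt0.
have bg : bmeas (ab : set (measurableTypeR R)) g by exact: bmeas_kernel.
have bD f : Cn_on ab n f -> bmeas (ab : set (measurableTypeR R)) (Dc f).
  by move=> hf; apply: cwithin_bmeas; exact: cwithin_diff_op.
have rep f : Cn_on ab n f ->
    calA f = cint (lebesgue_on a b) ab (fun t => g t * Dc f t).
  by move=> hf; exact: cintegral_representation.
have le0 F : bmeas (ab : set (measurableTypeR R)) F ->
    (forall t, ab t -> F t <= 0) -> cint (lebesgue_on a b) ab F <= 0.
  move=> bF F0; rewrite -oppr_ge0 -mulN1r -cintZ//; last exact: measurable_itv.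
  by apply: cint_ge0 => t abt; rewrite mulN1r oppr_ge0; exact: F0.
split.
- move=> f hf p q p1 q1 pq; rewrite rep//.
  by apply: cint_hoelder => //; exact: bD.
- move=> _ _ f hf _ sgn; rewrite rep//; apply: cint_ge0 => t abt.
  by case: sgn => -[g0 D0]; [apply: mulr_ge0|apply: mulr_le0];
    [exact: g0|exact: D0|exact: g0|exact: D0].
- move=> _ _ f hf _ sgn; rewrite rep//; apply: le0 => [|t abt].
    by apply: bmeasM => //; exact: bD.
  by case: sgn => -[g0 D0]; [apply: mulr_ge0_le0|apply: mulr_le0_ge0];
    [exact: g0|exact: D0|exact: g0|exact: D0].
Qed.
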